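(* Let $(D,G)$ be a group pair with Manin pair $(\mathfrak d,\mathfrak g)$, let $\mathfrak h,\mathfrak h'$ be two isotropic complements of $\mathfrak g$ in $\mathfrak d$, and let $t\in\bigwedge^2\mathfrak g$ be the twist from $\mathfrak h$ to $\mathfrak h'$. Let $G$ act on a manifold $M$ with a bivector $P_M^{\mathfrak h}$, and set $P_M^{\mathfrak h'}=P_M^{\mathfrak h}-t_M$. If the action of the quasi-Poisson Lie group $G_D^{\mathfrak h}$ on $(M,P_M^{\mathfrak h})$ is quasi-Poisson, then the action of $G_D^{\mathfrak h'}$ on $(M,P_M^{\mathfrak h'})$ is quasi-Poisson.
   Context: Everything is real, finite-dimensional and smooth; ''bivector'' on a manifold means bivector field. $a\wedge b=a\otimes b-b\otimes a$. Manin pair $(\mathfrak d,\mathfrak g)$: a Lie algebra $\mathfrak d$ of dimension $2n$ with an invariant nondegenerate symmetric bilinear form $(\cdot|\cdot)$ of signature $(n,n)$, and a Lie subalgebra $\mathfrak g\subset\mathfrak d$ that is a maximal isotropic subspace. A group pair $(D,G)$: a connected Lie group $D$ with a bi-invariant scalar product and a connected closed Lie subgroup $G$ whose Lie algebras form a Manin pair $(\mathfrak d,\mathfrak g)$. For an isotropic linear complement $\mathfrak h$, $\mathfrak d=\mathfrak g\oplus\mathfrak h$, let $p_{\mathfrak g},p_{\mathfrak h}$ be the projections and $j:\mathfrak g^*\to\mathfrak h$ the isomorphism with $(j(\xi)|x)=\langle\xi,x\rangle$. $F_{\mathfrak h}:\mathfrak g\to\bigwedge^2\mathfrak g$ is given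 by $F_{\mathfrak h}(x)(\xi,\eta)=\langle j^{-1}p_{\mathfrak h}[j\xi,j\eta],x\rangle$ and $\varphi_{\mathfrak h}\in\bigwedge^3\mathfrak g$ by $\varphi_{\mathfrak h}(\xi,\eta,\zeta)=\langle\zeta,p_{\mathfrak g}[j\xi,j\eta]\rangle$; $F_{\mathfrak h'},\varphi_{\mathfrak h'}$ are defined in the same way from $\mathfrak h'$, its projections and its isomorphism $j':\mathfrak g^*\to\mathfrak h'$. The twist from $\mathfrak h$ to $\mathfrak h'$ is $t=j'-j:\mathfrak g^*\to\mathfrak g$ (it takes values in $\mathfrak g$ and is anti-symmetric), regarded as $t\in\bigwedge^2\mathfrak g$ via $t(\xi,\eta)=\langle t(\xi),\eta\rangle$. With a basis $(e_i)$ of $\mathfrak g$ and dual basis $(\varepsilon^i)$ of $\mathfrak g^*$, $r_{\mathfrak d}=\sum_i e_i\otimes j(\varepsilon^i)$. $G_D^{\mathfrak h}$ is $G$ with the bivector obtained by restricting $r_{\mathfrak d}^\lambda-r_{\mathfrak d}^\rho$ (left- minus right-invariant tensors) to $G$ and with $\varphi_{\mathfrak h}$ (a quasi-Poisson Lie group). For $x\in\mathfrak g$, $x_M$ is the vector field $(x_Mf)(m)=\frac{d}{dt}f(\exp(-tx)m)|_{t=0}$, extended multiplicatively to $\bigwedge\mathfrak g$. The action of $G_D^{\mathfrak h}$ on $(M,P_M)$ is quasi-Poisson if $\frac12[P_M,P_M]=(\varphi_{\mathfrak h})_M$ and $\mathcal L_{x_M}P_M=-F_{\mathfrak h}(x)_M$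 for all $x\in\mathfrak g$. The Schouten bracket is normalized by $\frac12[P,P](df,dg,dh)=\{f,\{g,h\}\}+\{g,\{h,f\}\}+\{h,\{f,g\}\}$, where $\{f,g\}=P(df,dg)$. *)

(* Defs.v *)
From HB Require Import structures.
From mathcomp Require Import all_boot all_order all_algebra.
From mathcomp Require Import all_classical all_reals all_analysis.

Set Implicit Arguments.
Unset Strict Implicit.
Unset Printing Implicit Defensive.

Import Order.TTheory GRing.Theory Num.Theory.
Import numFieldNormedType.Exports.

Local Open Scope classical_set_scope.
Local Open Scope ring_scope.

(* Only meant for open [U], where continuity within [U] is continuity at the
   points of [U] and partial derivatives only depend on [f] on [U]. *)
Fixpoint Ck_on (R : realType) (n : nat) (k : nat)
    (U : set 'rV[R]_n) (f : 'rV[R]_n -> R) : Prop :=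
  (forall u, U u -> {for u, continuous f}) /\
  (if k is l.+1 then
     forall i : 'I_n,
       (forall u, U u -> derivable f u (delta_mx 0 i)) /\
       Ck_on l U (fun u => 'D_(delta_mx 0 i) f u)
   else True).

Definition smooth_on (R : realType) (n : nat)
    (U : set 'rV[R]_n) (f : 'rV[R]_n -> R) : Prop :=
  forall k, Ck_on k U f.

(* [fwd] and [bwd] are total functions, with irrelevant values outside
   [dom] and [fwd @` dom]. *)
Record chart (R : realType) (T : topologicalType) (n : nat) := Chart {
  dom : set T;
  fwd : T -> 'rV[R]_n;
  bwd : 'rV[R]_n -> T }.

Definition img (R : realType) (T : topologicalType) (n : nat)
  (c : chart R T n) : set 'rV[R]_n := fwd c @` dom c.

Definition chart_axiom (R : realType) (T : topologicalType) (n : nat)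
    (c : chart R T n) : Prop :=
  [/\ open (dom c), open (img c),
      {in dom c, cancel (fwd c) (bwd c)},
      forall x, dom c x -> {for x, continuous (fwd c)} &
      forall u, img c u -> {for u, continuous (bwd c)}].

Definition compatible (R : realType) (T : topologicalType) (n : nat)
    (c c' : chart R T n) : Prop :=
  forall i : 'I_n,
    smooth_on (fwd c @` (dom c `&` dom c')) (fun u => fwd c' (bwd c u) 0 i).

(* The data of a manifold without its axioms, so that products and the real
   line can serve as sources of smooth maps. *)
Record premanifold (R : realType) := Premanifold {
  carrier :> topologicalType;
  mdim : nat;
  atlas : set (chart R carrier mdim) }.

Arguments atlas {R} p.

Definition manifold_axiom (R : realType) (X : premanifold R) : Prop :=
  [/\ hausdorff_space X, @second_countable X,
      forall c, atlas X c -> chart_axiom c,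
      forall x : X, exists2 c, atlas X c & dom c x &
      forall c c', atlas X c -> atlas X c' -> compatible c c'].

Record manifold (R : realType) := Manifold {
  premanifold_of :> premanifold R;
  manifoldP : manifold_axiom premanifold_of }.

Definition smooth_fun (R : realType) (X : premanifold R) (f : X -> R) : Prop :=
  forall c, atlas X c -> smooth_on (img c) (f \o bwd c).

Definition smooth_map (R : realType) (X Y : premanifold R) (F : X -> Y) : Prop :=
  continuous F /\
  forall c c', atlas X c -> atlas Y c' -> forall i : 'I_(mdim Y),
    smooth_on (fwd c @` (dom c `&` F @^-1` dom c'))
              (fun u => fwd c' (F (bwd c u)) 0 i).

Definition prod_chart (R : realType) (S T : topologicalType) (m n : nat)
    (c : chart R S m) (c' : chart R T n) : chart R (S * T)%type (m + n) :=
  Chart (dom c `*` dom c')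
        (fun p => row_mx (fwd c p.1) (fwd c' p.2))
        (fun u => (bwd c (lsubmx u), bwd c' (rsubmx u))).

Definition prodM (R : realType) (X Y : premanifold R) : premanifold R :=
  Premanifold [set prod_chart c c' | c in atlas X & c' in atlas Y].

Definition lineM (R : realType) : premanifold R :=
  @Premanifold R R 1 [set Chart setT (fun t : R => \row_(k < 1) t)
                                     (fun u : 'rV[R]_1 => u 0 0)].

(* Tangent vectors, vector fields and bivector fields are derivations.  They act on
   all functions [X -> R], but only their values on smooth functions are
   constrained, and only these are ever compared. *)
Definition tangent (R : realType) (X : premanifold R) (p : X)
    (u : (X -> R) -> R) : Prop :=
  forall f g : X -> R, smooth_fun f -> smooth_fun g ->
    (forall a : R, u (fun q => a * f q + g q) = a * u f + u g) /\
    u (fun q => f q * g q) = u f * g p + f p * u g.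

Definition vector_field (R : realType) (X : premanifold R)
    (V : (X -> R) -> X -> R) : Prop :=
  (forall f, smooth_fun f -> smooth_fun (V f)) /\
  (forall p, tangent p (fun f => V f p)).

(* [P f g] is [P(df, dg)]. *)
Definition bivector (R : realType) (X : premanifold R)
    (P : (X -> R) -> (X -> R) -> X -> R) : Prop :=
  (forall f, smooth_fun f -> vector_field (P f)) /\
  (forall f g p, smooth_fun f -> smooth_fun g -> P f g p = - P g f p).

(* [1/2 [P, P](df, dg, dh)], with the Schouten bracket normalized so that this
   is the Jacobiator of [{f, g} = P(df, dg)]. *)
Definition half_schouten (R : realType) (X : premanifold R)
    (P : (X -> R) -> (X -> R) -> X -> R) (f g h : X -> R) (p : X) : R :=
  P f (P g h) p + P g (P h f) p + P h (P f g) p.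

Definition lie_derivative (R : realType) (X : premanifold R)
    (V : (X -> R) -> X -> R) (P : (X -> R) -> (X -> R) -> X -> R)
    (f g : X -> R) (p : X) : R :=
  V (P f g) p - P (V f) g p - P f (V g) p.

Record lieGroup (R : realType) := LieGroup {
  manifold_of :> manifold R;
  one : manifold_of;
  mul : manifold_of -> manifold_of -> manifold_of;
  inv : manifold_of -> manifold_of;
  mulA : associative mul;
  mul1 : left_id one mul;
  mulV : left_inverse one inv mul;
  mul_smooth : smooth_map (fun p : prodM manifold_of manifold_of => mul p.1 p.2);
  inv_smooth : smooth_map inv }.

Arguments one {R l}.
Arguments mul {R l}.

Definition left_invariant (R : realType) (G : lieGroup R)
    (V : (G -> R) -> G -> R) : Prop :=
  vector_field V /\
  (forall (a : G) (f : G -> R), smooth_fun f ->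
     forall b, V (f \o mul a) b = V f (mul a b)).

(* A vector space [lie_sort] identified, through the linear bijection
   [x |-> linv x], with the Lie algebra of left-invariant vector fields. *)
Record lieAlgebra (R : realType) (G : lieGroup R) := LieAlgebra {
  lie_sort :> vectType R;
  linv : lie_sort -> (G -> R) -> G -> R;
  bracket : lie_sort -> lie_sort -> lie_sort;
  linvP : forall x, left_invariant (linv x);
  linv_linear : forall (a : R) x y f b, smooth_fun f ->
    linv (a *: x + y) f b = a * linv x f b + linv y f b;
  linv_inj : forall x, (forall f b, smooth_fun f -> linv x f b = 0) -> x = 0;
  linv_surj : forall V, left_invariant V ->
    exists x, forall f b, smooth_fun f -> linv x f b = V f b;
  linv_bracket : forall x y f b, smooth_fun f ->
    linv (bracket x y) f b = linv x (linv y f) b - linv y (linv x f) b }.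

Arguments linv {R G l}.
Arguments bracket {R G l}.

(* [expG] is the exponential map: [t |-> expG (t x)] is the one-parameter
   subgroup of [G] with velocity [x] at [t = 0]. *)
Definition exponential (R : realType) (G : lieGroup R) (g : lieAlgebra G)
    (expG : g -> G) : Prop :=
  forall x : g,
    [/\ @smooth_map R (lineM R) G (fun t : R => expG (t *: x)),
        forall s t : R, expG ((s + t) *: x) = mul (expG (s *: x)) (expG (t *: x)) &
        forall f : G -> R, smooth_fun f ->
          is_derive (0 : R) (1 : R) (fun t : R => f (expG (t *: x))) (linv x f one)].

(* [i] is the differential at the identity of the morphism [iota]. *)
Definition lie_differential (R : realType) (D G : lieGroup R)
    (d : lieAlgebra D) (g : lieAlgebra G) (iota : G -> D) (i : 'Hom(g, d)) : Prop :=
  forall (x : g) (f : D -> R), smooth_fun f ->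
    linv (i x) f one = linv x (f \o iota) one.

(* [q p] is a scalar product, of any signature, on the tangent space at [p]; the
   first clause says that it only depends on values at smooth functions. *)
Definition biinvariant_scalar_product (R : realType) (D : lieGroup R)
    (q : D -> ((D -> R) -> R) -> ((D -> R) -> R) -> R) : Prop :=
  [/\ forall p u u' v, tangent p u -> tangent p u' -> tangent p v ->
        (forall f, smooth_fun f -> u f = u' f) -> q p u v = q p u' v,
      forall p u u' v (a : R), tangent p u -> tangent p u' -> tangent p v ->
        q p (fun f => a * u f + u' f) v = a * q p u v + q p u' v,
      forall p u v, tangent p u -> tangent p v -> q p u v = q p v u &
      forall p u, tangent p u -> (forall v, tangent p v -> q p u v = 0) ->
        forall f, smooth_fun f -> u f = 0] /\
  [/\ forall V W, vector_field V -> vector_field W ->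
        smooth_fun (fun p => q p (V ^~ p) (W ^~ p)),
      forall a p u v, tangent p u -> tangent p v ->
        q (mul a p) (fun f => u (f \o mul a)) (fun f => v (f \o mul a)) = q p u v &
      forall a p u v, tangent p u -> tangent p v ->
        q (mul p a) (fun f => u (f \o (mul ^~ a))) (fun f => v (f \o (mul ^~ a)))
        = q p u v].

(* The subgroup is the image of [iota], a closed topological embedding (second
   clause) and an immersion (third clause). *)
Definition connected_closed_subgroup (R : realType) (D G : lieGroup R)
    (iota : G -> D) : Prop :=
  [/\ connected [set: G], smooth_map iota,
      {morph iota : a b / mul a b >-> mul a b}, injective iota &
      closed (range iota)] /\
  (forall U : set G, open U -> exists2 V : set D, open V & U = iota @^-1` V) /\
  (forall (p : G) u, tangent p u ->
     (forall f : D -> R, smooth_fun f -> u (f \o iota) = 0) ->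
     forall f : G -> R, smooth_fun f -> u f = 0).

Definition group_pair (R : realType) (D G : lieGroup R) (iota : G -> D)
    (q : D -> ((D -> R) -> R) -> ((D -> R) -> R) -> R) : Prop :=
  [/\ connected [set: D], biinvariant_scalar_product q &
      connected_closed_subgroup iota].

(* The form induced on the Lie algebra, i.e. on the tangent space at [one]. *)
Definition lie_form (R : realType) (D : lieGroup R) (d : lieAlgebra D)
    (q : D -> ((D -> R) -> R) -> ((D -> R) -> R) -> R) (x y : d) : R :=
  q one (fun f => linv x f one) (fun f => linv y f one).

Definition isotropic (R : realType) (d : vectType R) (B : d -> d -> R)
    (U : {vspace d}) : Prop :=
  {in U &, forall x y, B x y = 0}.

Definition maximal_isotropic (R : realType) (d : vectType R) (B : d -> d -> R)
    (U : {vspace d}) : Prop :=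
  isotropic B U /\ (forall W, isotropic B W -> (U <= W)%VS -> W = U).

Definition split_signature (R : realType) (d : vectType R) (n : nat)
    (B : d -> d -> R) : Prop :=
  exists2 b : (n + n).-tuple d, basis_of fullv b &
    forall k l : 'I_(n + n),
      B (tnth b k) (tnth b l) =
      if k == l then (if (k < n)%N then 1 else -1) else 0.

Definition manin_pair (R : realType) (d : vectType R) (br : d -> d -> d)
    (n : nat) (B : d -> d -> R) (U : {vspace d}) : Prop :=
  [/\ \dim {:d} = (n + n)%N,
      [/\ forall (a : R) x y z, B (a *: x + y) z = a * B x z + B y z,
          forall x y, B x y = B y x,
          forall x, (forall y, B x y = 0) -> x = 0,
          forall x y z, B (br x y) z = B x (br y z) &
          split_signature n B],
      {in U &, forall x y, br x y \in U} &
      maximal_isotropic B U].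

Definition isotropic_complement (R : realType) (d : vectType R)
    (B : d -> d -> R) (U h : {vspace d}) : Prop :=
  [/\ isotropic B h, (U + h = fullv)%VS & (U :&: h = 0)%VS].

(* [i : 'Hom(g, d)] is the inclusion of [g] in [d].  Elements of the exterior
   powers of [g] are given as multilinear forms on the dual of [g]. *)

Section Complement.
Context (R : realType) (d g : vectType R) (br : d -> d -> d) (B : d -> d -> R).
Context (i : 'Hom(g, d)).

(* [(i^-1)%VF] inverts [i] on its range [limg i]. *)
Definition proj_g (h : {vspace d}) (z : d) : g :=
  (i^-1)%VF (daddv_pi (limg i) h z).

Definition proj_h (h : {vspace d}) (z : d) : d := daddv_pi h (limg i) z.

(* [j(xi)] and, below, [j^-1(z)], through the properties that determine them. *)
Definition jmap (h : {vspace d}) (xi : 'Hom(g, R^o)) : d :=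
  xget 0 [set z | z \in h /\ forall x : g, B z (i x) = xi x].

Definition jmap_inv (h : {vspace d}) (z : d) : 'Hom(g, R^o) :=
  xget 0 [set xi | jmap h xi = z].

Definition Ftensor (h : {vspace d}) (x : g) (xi eta : 'Hom(g, R^o)) : R :=
  jmap_inv h (proj_h h (br (jmap h xi) (jmap h eta))) x.

Definition phitensor (h : {vspace d}) (xi eta zeta : 'Hom(g, R^o)) : R :=
  zeta (proj_g h (br (jmap h xi) (jmap h eta))).

Definition twist (h h' : {vspace d}) (xi : 'Hom(g, R^o)) : g :=
  (i^-1)%VF (jmap h' xi - jmap h xi).

Definition twist_tensor (h h' : {vspace d}) (xi eta : 'Hom(g, R^o)) : R :=
  eta (twist h h' xi).

End Complement.

Definition smooth_action (R : realType) (G : lieGroup R) (M : manifold R)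
    (act : G -> M -> M) : Prop :=
  [/\ smooth_map (fun p : prodM G M => act p.1 p.2),
      forall m, act one m = m &
      forall a b m, act (mul a b) m = act a (act b m)].

Section Action.
Context (R : realType) (G : lieGroup R) (g : lieAlgebra G) (expG : g -> G).
Context (M : manifold R) (act : G -> M -> M).

(* The function [x_M f]. *)
Definition fund (x : g) (f : M -> R) (m : M) : R :=
  derive1 (fun t : R => f (act (expG ((- t) *: x)) m)) 0.

Definition dual_basis (k : 'I_(\dim {:g})) : 'Hom(g, R^o) :=
  linfun (coord (vbasis {:g}) k : g -> R^o).

(* [T_M(df1, df2)].  With the convention that the wedge of [a] and [b] is
   [a (x) b - b (x) a], the bivector [T] is the tensor
   [sum_kl T(eps^k, eps^l) e_k (x) e_l], and likewise in degree 3. *)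
Definition fund2 (T : 'Hom(g, R^o) -> 'Hom(g, R^o) -> R)
    (f1 f2 : M -> R) (m : M) : R :=
  \sum_k \sum_l T (dual_basis k) (dual_basis l) *
    (fund (vbasis {:g})`_k f1 m * fund (vbasis {:g})`_l f2 m).

Definition fund3 (T : 'Hom(g, R^o) -> 'Hom(g, R^o) -> 'Hom(g, R^o) -> R)
    (f1 f2 f3 : M -> R) (m : M) : R :=
  \sum_k \sum_l \sum_p T (dual_basis k) (dual_basis l) (dual_basis p) *
    (fund (vbasis {:g})`_k f1 m * fund (vbasis {:g})`_l f2 m * fund (vbasis {:g})`_p f3 m).

Definition quasi_poisson_action
    (F : g -> 'Hom(g, R^o) -> 'Hom(g, R^o) -> R)
    (phi : 'Hom(g, R^o) -> 'Hom(g, R^o) -> 'Hom(g, R^o) -> R)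
    (P : (M -> R) -> (M -> R) -> M -> R) : Prop :=
  [/\ bivector P,
      forall f1 f2 f3 m, smooth_fun f1 -> smooth_fun f2 -> smooth_fun f3 ->
        half_schouten P f1 f2 f3 m = fund3 phi f1 f2 f3 m &
      forall x f1 f2 m, smooth_fun f1 -> smooth_fun f2 ->
        lie_derivative (fund x) P f1 f2 m = - fund2 (F x) f1 f2 m].

End Action.

(* Main.v *)
Require Import Defs.
From mathcomp Require Import all_boot all_order all_algebra.
From mathcomp Require Import all_classical all_reals all_analysis.
From HB Require Import structures.
From mathcomp Require Import ring lra.
Import Defs.
Import Order.TTheory GRing.Theory Num.Theory.
Import numFieldNormedType.Exports.
Local Open Scope ring_scope.

(** The equation [j' = j + i t] and the invariance of the form give
    [F'(x)(xi, eta) = F(x)(xi, eta) + eta [x, t xi] - xi [x, t eta]] and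
    [phi'(xi, eta, zeta) = phi(xi, eta, zeta)
      + cyclic sum of F(t zeta)(xi, eta) + cyclic sum of zeta [t xi, t eta]].
    With [X_k], [Y_k] the fundamental fields of [e_k] and [t eps^k], the bivector
    [t_M] is [sum_k X_k (x) Y_k], and antisymmetry of [t] allows to exchange [X]
    and [Y] at the cost of a sign.  The Leibniz rule then yields the two terms of
    [F' - F] from [L_x t_M].  In the Jacobiator of [P - t_M] the terms which
    contain [P] cancel in pairs, apart from those coming from [L_(Y_k) P], which
    are the [F]-terms of [phi']; the second derivatives in the Jacobiator of
    [t_M] only occur through the commutators [[Y_k, Y_l]], the fundamental fields
    of the brackets [[t eps^k, t eps^l]].

    The fundamental field of [x] is [f |-> - linv x (a |-> f (a m))] at [m], so it
    is linear in [x]; compatibility with brackets is the symmetry of the second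
    derivatives of [(s, t) |-> f (exp (t y) exp (s x) m)]. *)

Set Implicit Arguments.
Unset Strict Implicit.
Unset Printing Implicit Defensive.
Local Open Scope classical_set_scope.

(** * Continuously differentiable functions *)

Section Calculus.
Context {R : realType} {n : nat}.
Implicit Types (f : 'rV[R]_n -> R) (u v w : 'rV[R]_n) (U : set 'rV[R]_n).

Lemma ball_rVP u v (e : R) :
  ball u e v <-> 0 < e /\ forall i, `|u 0 i - v 0 i| < e.
Proof.
split=> [[e0 uv]|[e0 uv]]; first by split=> // i; exact: uv.
by split=> // i j; rewrite ord1; exact: uv.
Qed.

Lemma continuous_rVP f u : {for u, continuous f} <->
  forall e, 0 < e -> exists2 d : R, 0 < d & forall x, ball u d x -> `|f u - f x| < e.
Proof.
have FF := nbhs_filter u; split=> [/cvgrPdist_lt cf e e0|H].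
  by have /(nbhs_ballP u)[d d0 de] := cf e e0; exists d.
apply/cvgrPdist_lt => e e0; have [d d0 de] := H e e0.
by apply/(nbhs_ballP u); exists d.
Qed.

Lemma eq_of_continuous f g u r : 0 < r ->
  {for u, continuous f} -> {for u, continuous g} ->
  (forall d, 0 < d -> d <= r ->
    exists2 x, ball u d x & exists2 y, ball u d y & f x = g y) ->
  f u = g u.
Proof.
move=> r0 /continuous_rVP cf /continuous_rVP cg fg.
apply/eqP; rewrite -subr_eq0 -normr_le0; apply/ler_addgt0Pl => a a0; rewrite addr0.
have a20 : 0 < a / 2 by rewrite divr_gt0.
have [r1 r10 r1e] := cf _ a20; have [r2 r20 r2e] := cg _ a20.
pose d := Num.min r (Num.min r1 r2).
have d0 : 0 < d by rewrite !lt_min r0 r10 r20.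
have [dr dr1 dr2] : [/\ d <= r, d <= r1 & d <= r2].
  by rewrite /d !ge_min !lexx !orbT.
have [x xb [y yb E]] := fg d d0 dr.
have := r1e _ (le_ball dr1 xb); have := r2e _ (le_ball dr2 yb); rewrite -E => b1 b2.
rewrite -(subrK (f x) (f u)) -addrA [leRHS]splitr.
by rewrite (le_trans (ler_normD _ _)) // ltW // ltrD // distrC.
Qed.

Lemma is_derive_line f u v (s : R) : derivable f (u + s *: v) v ->
  is_derive s (1 : R) (fun s : R => f (u + s *: v)) ('D_v f (u + s *: v)).
Proof.
move=> df.
have E : (fun h : R => h^-1 *: (((fun s : R => f (u + s *: v)) \o shift s) (h *: 1)
     - f (u + s *: v))) =
  (fun h : R => h^-1 *: ((f \o shift (u + s *: v)) (h *: v) - f (u + s *: v))).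
  apply/funext => h /=; congr (_ *: (f _ - _)).
  by rewrite -[h *: 1]/(h * 1) mulr1 scalerDl addrCA.
by split; [rewrite /derivable E|rewrite /derive E].
Qed.

Lemma line_MVT f u v (t : R) :
  (forall s, `|s| <= `|t| -> derivable f (u + s *: v) v) ->
  exists2 s, `|s| <= `|t| & f (u + t *: v) - f u = t * 'D_v f (u + s *: v).
Proof.
move=> df; set g := fun s : R => f (u + s *: v).
have dg s : `|s| <= `|t| -> is_derive s (1 : R) g ('D_v f (u + s *: v)).
  by move=> st; apply/is_derive_line/df.
have cg (a b : R) : (forall s, a <= s <= b -> `|s| <= `|t|) ->
    {within `[a, b], continuous g}.
  move=> H; apply: derivable_within_continuous => s; rewrite in_itv /= => sab.
  by have [] := dg s (H s sab).
have g0 : g 0 = f u by rewrite /g scale0r addr0.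
have [t0|t0] := leP 0 t.
  have H (s : R) : 0 <= s <= t -> `|s| <= `|t|.
    by move=> /andP[s0 st]; rewrite !ger0_norm.
  have [|s] := @MVT_segment _ g (fun s => 'D_v f (u + s *: v)) 0 t t0 _ (cg _ _ H).
    move=> s; rewrite in_itv /= => /andP[/ltW a /ltW b]; apply/dg/H.
    by rewrite a b.
  rewrite in_itv /= => sI; rewrite g0 subr0 mulrC => gE.
  by exists s => //; exact: H.
have H (s : R) : t <= s <= 0 -> `|s| <= `|t|.
  by move=> /andP[s0 st]; rewrite !ler0_norm ?lerN2 // ltW.
have [|s] := @MVT_segment _ g (fun s => 'D_v f (u + s *: v)) t 0 (ltW t0) _ (cg _ _ H).
  move=> s; rewrite in_itv /= => /andP[/ltW a /ltW b]; apply/dg/H.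
  by rewrite a b.
rewrite in_itv /= => sI; rewrite g0 sub0r mulrN mulrC => gE.
by exists s; [exact: H|rewrite -[t * _]opprK -gE opprB].
Qed.

(* Carathéodory's form of differentiability. *)
Lemma C1_slope f U u : open U -> Ck_on 1 U f -> U u ->
  exists q : 'I_n -> 'rV[R]_n -> R,
    (forall j, {for u, continuous (q j)} /\ q j u = 'D_(delta_mx 0 j) f u) /\
    (forall x, f x - f u = \sum_j q j x * (x 0 j - u 0 j)).
Proof.
move=> oU [_ df] Uu.
pose w (x : 'rV[R]_n) (j : nat) : 'rV[R]_n :=
  \row_i (if (i < j)%N then x 0 i else u 0 i).
have wS x (j : 'I_n) : w x j.+1 = w x j + (x 0 j - u 0 j) *: delta_mx 0 j.
  apply/rowP => i; rewrite !mxE /= ltnS leq_eqVlt.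
  have [/val_inj ->|ij] := eqVneq (i : nat) j.
    by rewrite ltnn eqxx /= mulr1 addrC subrK.
  have /negPf -> : i != j by apply: contra ij => /eqP ->.
  by rewrite mulr0 addr0.
exists (fun j (x : 'rV[R]_n) => if x 0 j == u 0 j then 'D_(delta_mx 0 j) f u
  else (f (w x j.+1) - f (w x j)) / (x 0 j - u 0 j)); split; last first.
  move=> x; transitivity (\sum_(j < n) (f (w x j.+1) - f (w x j))).
    rewrite -(big_mkord xpredT (fun j => f (w x j.+1) - f (w x j))).
    rewrite telescope_sumr //; congr (f _ - f _).
      by apply/rowP => i; rewrite mxE ltn_ord.
    by apply/rowP => i; rewrite mxE.
  apply: eq_bigr => j _; have [xu|xu] := eqVneq (x 0 j) (u 0 j).
    by rewrite wS xu subrr scale0r addr0 subrr mulr0.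
  by rewrite divfK // subr_eq0.
move=> j; split; last by rewrite eqxx.
apply/continuous_rVP => e e0; rewrite eqxx; have [dfj [cfj _]] := df j.
have /(nbhs_ballP u) [r r0 rU] := open_nbhs_nbhs (conj oU Uu).
have /continuous_rVP/(_ e e0)[r' r'0 r'e] := cfj u Uu.
exists (Num.min r r'); first by rewrite lt_min; apply/andP.
move=> x /ball_rVP[m0 xu] /=; case: eqVneq => [|xuj]; first by rewrite subrr normr0.
have inb s : `|s| <= `|x 0 j - u 0 j| ->
    ball u (Num.min r r') (w x j + s *: delta_mx 0 j).
  move=> st; apply/ball_rVP; split => // i; rewrite !mxE /=.
  have [->|ij] := eqVneq i j.
    rewrite ltnn mulr1 opprD addrA subrr sub0r normrN (le_lt_trans st) //.
    by rewrite distrC.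
  by rewrite mulr0 addr0; case: ifP => _ //; rewrite subrr normr0.
rewrite wS; have [|s st ->] := @line_MVT f (w x j) (delta_mx 0 j) (x 0 j - u 0 j).
  move=> s /inb sb; apply/dfj/rU; apply: le_ball sb.
  by rewrite ge_min lexx.
rewrite mulrAC divff ?subr_eq0 // mul1r.
by apply/r'e/(le_ball _ (inb s st)); rewrite ge_min lexx orbT.
Qed.

(* Both mixed derivatives are values, at nearby points, of the same second
   difference divided by h ^ 2. *)
Lemma schwarz f U u (i j : 'I_n) : open U -> Ck_on 2 U f -> U u ->
  'D_(delta_mx 0 i) (fun x => 'D_(delta_mx 0 j) f x) u =
  'D_(delta_mx 0 j) (fun x => 'D_(delta_mx 0 i) f x) u.
Proof.
move=> oU [_ df] Uu.
have /(nbhs_ballP u) [r r0 rU] := open_nbhs_nbhs (conj oU Uu).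
pose e k : 'rV[R]_n := delta_mx 0 k.
have eE k l : `|e k 0 l| <= 1.
  by rewrite mxE; case: (_ && _); rewrite ?normr1 ?normr0.
have inb (d s s' : R) k l : 0 < d -> `|s| <= d / 3 -> `|s'| <= d / 3 ->
    ball u d (u + s *: e k + s' *: e l).
  move=> d0 sd s'd; apply/ball_rVP; split => // m.
  rewrite mxE [X in _ - (X + _)]mxE [X in _ - (_ + X + _)]mxE [X in _ - (_ + X)]mxE.
  have -> : u 0 m - (u 0 m + s * e k 0 m + s' * e l 0 m) =
    - (s * e k 0 m + s' * e l 0 m) by ring.
  rewrite normrN (le_lt_trans (ler_normD _ _)) // !normrM.
  have := ler_pM (normr_ge0 s) (normr_ge0 _) sd (eE k m).
  have := ler_pM (normr_ge0 s') (normr_ge0 _) s'd (eE l m).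
  rewrite !mulr1 => *; lra.
have main k l (d : R) : 0 < d -> d <= r -> exists2 x, ball u d x &
    f (u + (d / 3) *: e k + (d / 3) *: e l) - f (u + (d / 3) *: e k)
    - (f (u + (d / 3) *: e l) - f u) =
    (d / 3) * ((d / 3) * 'D_(e l) (fun x => 'D_(e k) f x) x).
  move=> d0 dr; set h := d / 3.
  have h0 : 0 < h by rewrite /h; lra.
  have hh : `|h| = h by rewrite gtr0_norm.
  have dfD m x : U x -> derivable f x (e m) by have [+ _] := df m; apply.
  have sub x : ball u d x -> U x by move=> xd; apply/rU/(le_ball dr xd).
  pose g := (f \o shift (h *: e l)) - f.
  have dshift x : U (x + h *: e l) ->
      is_derive x (e k) (f \o shift (h *: e l)) ('D_(e k) f (x + h *: e l)).
    move=> Ux; have E : (fun t : R => t^-1 *: (((f \o shift (h *: e l)) \o shift x)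
        (t *: e k) - (f \o shift (h *: e l)) x)) =
      (fun t : R => t^-1 *: ((f \o shift (x + h *: e l)) (t *: e k)
        - f (x + h *: e l))).
      by apply/funext => t /=; rewrite addrA.
    by split; [rewrite /derivable E; exact: dfD|rewrite /derive E].
  have dg s : `|s| <= h -> is_derive (u + s *: e k) (e k) g
      ('D_(e k) f (u + s *: e k + h *: e l) - 'D_(e k) f (u + s *: e k)).
    move=> sh; apply: is_deriveB.
      by apply/dshift/sub/inb => //; rewrite hh.
    apply/derivableP/dfD/sub; rewrite -[_ + _]addr0 -(scale0r (e l)).
    by apply: inb => //; rewrite normr0 ltW.
  have [|s] := @line_MVT g u (e k) h.
    by move=> s; rewrite hh => /dg[].
  rewrite hh => sh; have [_ ->] := dg s sh.
  have [|s'] := @line_MVT (fun x => 'D_(e k) f x) (u + s *: e k) (e l) h.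
    move=> s'; rewrite hh => s'h; have [_ [_ d2]] := df k.
    have [+ _] := d2 l; apply; apply/sub/inb => //.
  rewrite hh => s'h -> gE.
  exists (u + s *: e k + s' *: e l); first exact: inb.
  by rewrite -gE /g /= -[(_ - f) _]/(_ - f _) -[(_ - f) u]/(_ - f u).
have [_ [_ di]] := df i; have [_ [cij _]] := di j.
have [_ [_ dj]] := df j; have [_ [cji _]] := dj i.
apply: (eq_of_continuous r0 (cji u Uu) (cij u Uu)) => d d0 dr.
have [y yb yE] := main j i d d0 dr; have [x xb xE] := main i j d d0 dr.
exists y; [exact: yb|exists x; first exact: xb].
have h0 : d / 3 != 0 by rewrite mulf_neq0 ?gt_eqF // invr_gt0.
have subAC (x1 x2 x3 x4 : R) : x1 - x2 - (x3 - x4) = x1 - x3 - (x2 - x4) by ring.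
apply: (mulfI h0); apply: (mulfI h0).
by rewrite -[LHS]yE -[RHS]xE subAC (addrAC u).
Qed.

End Calculus.

Lemma continuous_rV_coord (R : realType) (T : topologicalType) m
    (F : T -> 'rV[R]_m) t :
  (forall j, {for t, continuous (fun x => F x 0 j)}) -> {for t, continuous F}.
Proof.
move=> cF A /= /(nbhs_ballP (F t))[e e0 eA].
have FF := nbhs_filter t.
have H : \forall x \near t, forall j, `|F t 0 j - F x 0 j| < e.
  apply: filter_forall => j.
  by have /cvgrPdist_lt/(_ e e0) := cF j.
have sub x : (forall j, `|F t 0 j - F x 0 j| < e) -> A (F x).
  by move=> Hx; apply/eA/ball_rVP.
exact: filterS sub H.
Qed.

Section Chain.
Context {R : realType}.

Lemma is_derive_comp_rV (W : normedModType R) m (f : 'rV[R]_m -> R)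
    (F : W -> 'rV[R]_m) V (u v : W) :
  open V -> Ck_on 1 V f -> V (F u) ->
  (forall j, derivable (fun x => F x 0 j) u v) ->
  is_derive u v (f \o F)
    (\sum_j 'D_(delta_mx 0 j) f (F u) * 'D_v (fun x => F x 0 j) u).
Proof.
move=> oV Cf VF dF; have [q [qc qE]] := C1_slope oV Cf VF.
have cF : {for 0, continuous (fun h : R => F (h *: v + u))}.
  apply: continuous_rV_coord => j.
  have := (derivable1P (fun x => F x 0 j) u v).1 (dF j).
  by move=> /derivable1_diffP/differentiable_continuous.
have lim : (fun h : R => h^-1 *: (((f \o F) \o shift u) (h *: v) - (f \o F) u)) @ 0^'
    --> \sum_j 'D_(delta_mx 0 j) f (F u) * 'D_v (fun x => F x 0 j) u.
  have -> : (fun h : R => h^-1 *: (((f \o F) \o shift u) (h *: v) - (f \o F) u)) =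
    (fun h : R => \sum_j q j (F (h *: v + u)) *
       (h^-1 *: (((fun x => F x 0 j) \o shift u) (h *: v) - F u 0 j))).
    apply/funext => h /=; rewrite qE scaler_sumr; apply: eq_bigr => j _.
    by rewrite -scalerAr.
  apply: cvg_big => [|j _]; first exact: add_continuous.
  apply: cvgM; last exact: dF.
  have [cq <-] := qc j.
  have cqF : {for 0, continuous (q j \o (fun h : R => F (h *: v + u)))}.
    apply: continuous_comp; first exact: cF.
    by rewrite /= scale0r add0r.
  by have /continuous_withinNx := cqF; rewrite /= scale0r add0r.
by split; [apply/cvg_ex; eexists; exact: lim|exact: cvg_lim lim].
Qed.

End Chain.

Section CkOn.
Context {R : realType} {n : nat}.
Implicit Types (f g : 'rV[R]_n -> R) (u v w : 'rV[R]_n) (U V : set 'rV[R]_n).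

Lemma Ck_on_sub k U V f : V `<=` U -> Ck_on k U f -> Ck_on k V f.
Proof.
move=> VU; elim: k f => [|k IH] f /= [cf df]; first by split=> // u /VU/cf.
split=> [u /VU/cf //|i]; have [di Di] := df i.
by split=> [u /VU/di //|]; exact: IH.
Qed.

Lemma Ck_on_pred k U f : Ck_on k.+1 U f -> Ck_on k U f.
Proof.
elim: k f => [|k IH] f [cf df]; first by split.
by split=> // i; have [di Di] := df i; split=> //; exact: IH.
Qed.

Lemma Ck_on_ge1 k U f : Ck_on k.+1 U f -> Ck_on 1 U f.
Proof. by elim: k => // k IH /Ck_on_pred. Qed.

Lemma near_open_eq U f g u : open U -> U u -> (forall u, U u -> f u = g u) ->
  \forall x \near u, f x = g x.
Proof.
move=> oU Uu fg; have FF := nbhs_filter u.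
have := open_nbhs_nbhs (conj oU Uu); exact: filterS.
Qed.

Lemma Ck_on_eq k U f g : open U -> (forall u, U u -> f u = g u) ->
  Ck_on k U f -> Ck_on k U g.
Proof.
move=> oU; elim: k f g => [|k IH] f g fg [cf df].
  split=> // u Uu; have FF := nbhs_filter u; have Ef := near_open_eq oU Uu fg.
  rewrite /prop_for /continuous_at -(fg u Uu).
  by apply: cvg_trans (cf u Uu); exact: near_eq_cvg Ef.
split=> [u Uu|i].
  have FF := nbhs_filter u; have Ef := near_open_eq oU Uu fg.
  rewrite /prop_for /continuous_at -(fg u Uu).
  by apply: cvg_trans (cf u Uu); exact: near_eq_cvg Ef.
have [di Di] := df i; split=> [u Uu|].
  exact: near_eq_derivable (near_open_eq oU Uu fg) (di u Uu).
apply: IH Di => u Uu; apply: near_eq_derive; exact: near_open_eq oU Uu fg.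
Qed.

Lemma Ck_on_local k U f :
  (forall u, U u -> exists2 V, V u & Ck_on k V f) -> Ck_on k U f.
Proof.
elim: k f => [|k IH] f H; first by split=> // u /H[V Vu [cf _]]; exact: cf.
split=> [u /H[V Vu [cf _]]|i]; first exact: cf.
split=> [u /H[V Vu [_ /(_ i)[di _]]]|]; first exact: di.
by apply: IH => u /H[V Vu [_ /(_ i)[_ Di]]]; exists V.
Qed.

Lemma Ck_on_cst k U (a : R) : Ck_on k U (fun=> a).
Proof.
elim: k a => [|k IH] a; split=> //; try by move=> u _; apply: (@cst_continuous).
move=> i; split=> [u _|]; first exact: derivable_cst.
have -> : (fun u : 'rV[R]_n => 'D_(delta_mx 0 i) (fun=> a) u) = fun=> 0.
  by apply/funext => u; exact: derive_cst.
exact: IH.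
Qed.

Lemma Ck_on_coord k U j : Ck_on k U (fun u => u 0 j).
Proof.
have dj (v x : 'rV[R]_n) : is_derive x v (fun u : 'rV[R]_n => u 0 j) (v 0 j).
  have lim : (fun h : R => h^-1 *: (((fun u : 'rV[R]_n => u 0 j) \o shift x) (h *: v)
      - x 0 j)) @ 0^' --> v 0 j.
    apply: cvg_near_cst; near=> h; rewrite /= !mxE addrK.
    have h0 : h != 0 by near: h; exact: nbhs_dnbhs_neq.
    by rewrite /GRing.scale /= mulKf.
  by split; [apply/cvg_ex; eexists; exact: lim|exact: cvg_lim lim].
case: k => [|k]; split=> //; try by move=> u _; exact: coord_continuous.
move=> i; split=> [u _|]; first by case: (dj (delta_mx 0 i) u).
have -> : (fun u : 'rV[R]_n => 'D_(delta_mx 0 i) (fun u : 'rV[R]_n => u 0 j) u) =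
    fun=> (delta_mx 0 i : 'rV[R]_n) 0 j.
  by apply/funext => u; case: (dj (delta_mx 0 i) u).
exact: Ck_on_cst.
Unshelve. all: by end_near. Qed.

Lemma Ck_on_add k U f g : open U ->
  Ck_on k U f -> Ck_on k U g -> Ck_on k U (fun u => f u + g u).
Proof.
move=> oU; elim: k f g => [|k IH] f g [cf df] [cg dg].
  by split=> // u Uu; apply: (continuousD (f := f)); [exact: cf|exact: cg].
split=> [u Uu|i]; first by apply: (continuousD (f := f)); [exact: cf|exact: cg].
have [dfi Dfi] := df i; have [dgi Dgi] := dg i; split=> [u Uu|].
  by apply: (@derivableD _ _ _ f g); [exact: dfi|exact: dgi].
apply: Ck_on_eq (IH _ _ Dfi Dgi) => // u Uu.
by rewrite -(@deriveD _ _ _ f g) //; [exact: dfi|exact: dgi].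
Qed.

Lemma Ck_on_mul k U f g : open U ->
  Ck_on k U f -> Ck_on k U g -> Ck_on k U (fun u => f u * g u).
Proof.
move=> oU; elim: k f g => [|k IH] f g Cf Cg; have [cf df] := Cf; have [cg dg] := Cg.
  by split=> // u Uu; apply: (continuousM (s := f)); [exact: cf|exact: cg].
split=> [u Uu|i]; first by apply: (continuousM (s := f)); [exact: cf|exact: cg].
have [dfi Dfi] := df i; have [dgi Dgi] := dg i; split=> [u Uu|].
  by apply: (@derivableM _ _ f g); [exact: dfi|exact: dgi].
have := Ck_on_add oU (IH _ _ (Ck_on_pred Cf) Dgi) (IH _ _ (Ck_on_pred Cg) Dfi).
apply: Ck_on_eq => // u Uu.
by rewrite (@deriveM _ _ f g) //; [exact: dfi|exact: dgi].
Qed.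

Lemma Ck_on_sum k U I (r : seq I) (F : I -> 'rV[R]_n -> R) : open U ->
  (forall i, Ck_on k U (F i)) -> Ck_on k U (fun u => \sum_(i <- r) F i u).
Proof.
move=> oU CF; elim: r => [|i r IH].
  by under eq_fun do rewrite big_nil; exact: Ck_on_cst.
by under eq_fun do rewrite big_cons; apply: Ck_on_add.
Qed.

End CkOn.

Lemma Ck_on_comp (R : realType) m n k (U : set 'rV[R]_n) (V : set 'rV[R]_m)
    (f : 'rV[R]_m -> R) (F : 'rV[R]_n -> 'rV[R]_m) :
  open U -> open V -> (forall u, U u -> V (F u)) ->
  Ck_on k V f -> (forall j, Ck_on k U (fun u => F u 0 j)) ->
  Ck_on k U (fun u => f (F u)).
Proof.
move=> oU oV UV; elim: k f => [|k IH] f Cf CF.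
  split=> // u Uu; apply: (continuous_comp (f := F)).
    by apply: continuous_rV_coord => j; case: (CF j) => + _; apply.
  by case: Cf => + _; apply; exact: UV.
split=> [u Uu|i].
  apply: (continuous_comp (f := F)).
    by apply: continuous_rV_coord => j; case: (CF j) => + _; apply.
  by case: Cf => + _; apply; exact: UV.
have dfF u : U u -> is_derive u (delta_mx 0 i) (f \o F)
    (\sum_j 'D_(delta_mx 0 j) f (F u) * 'D_(delta_mx 0 i) (fun x => F x 0 j) u).
  move=> Uu; apply: is_derive_comp_rV oV (Ck_on_ge1 Cf) (UV u Uu) _ => j.
  by case: (CF j) => _ /(_ i)[+ _]; apply.
split=> [u /dfF[]//|].
apply: (@Ck_on_eq _ _ _ _ (fun u => \sum_j 'D_(delta_mx 0 j) f (F u) *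
    'D_(delta_mx 0 i) (fun x => F x 0 j) u)) => // [u /dfF[]//|].
apply: Ck_on_sum => // j; apply: Ck_on_mul => //.
  apply: (IH (fun x => 'D_(delta_mx 0 j) f x)); first by case: Cf => _ /(_ j)[].
  by move=> l; exact: Ck_on_pred.
by case: (CF j) => _ /(_ i)[].
Qed.

(** * Charts and smooth maps *)

Definition charted (R : realType) (X : premanifold R) : Prop :=
  [/\ forall c, atlas X c -> chart_axiom c,
      forall x : X, exists2 c, atlas X c & dom c x &
      forall c c', atlas X c -> atlas X c' -> compatible c c'].

Lemma charted_manifold (R : realType) (X : manifold R) : charted X.
Proof. by case: (manifoldP X). Qed.

Section Charts.
Context {R : realType}.

Lemma open_fwd (T : topologicalType) n (c : chart R T n) (W : set T) :
  chart_axiom c -> open W -> open (fwd c @` (dom c `&` W)).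
Proof.
move=> [odom oimg cK cfwd cbwd] oW; rewrite openE => _ [x [dx Wx] <-].
have FF := nbhs_filter (fwd c x).
have iu : img c (fwd c x) by exists x.
have N1 : nbhs (fwd c x) (img c) by exact: open_nbhs_nbhs.
have N2 : nbhs (fwd c x) (bwd c @^-1` W).
  by apply: (cbwd _ iu); rewrite cK ?inE //; exact: open_nbhs_nbhs.
apply: filterS (filterI N1 N2) => _ [[y dy <-]] /=; rewrite cK ?inE // => Wy.
by exists y.
Qed.

Lemma smooth_comp_local (X Y : premanifold R) (F : X -> Y) (f : Y -> R) W c :
  charted X -> charted Y -> smooth_map F -> open W ->
  (forall c', atlas Y c' -> smooth_on (fwd c' @` (dom c' `&` W)) (f \o bwd c')) ->
  atlas X c ->
  smooth_on (fwd c @` (dom c `&` F @^-1` W)) (fun u => f (F (bwd c u))).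
Proof.
move=> [aX coverX _] [aY coverY _] [cF sF] oW fW Xc k.
have Ac := aX c Xc; have [_ _ cK _ _] := Ac.
apply: Ck_on_local => _ [x [dx Wx] <-].
have [c' Yc' dFx] := coverY (F x); have Ac' := aY c' Yc'; have [odom' _ c'K _ _] := Ac'.
pose V := fwd c @` (dom c `&` F @^-1` (W `&` dom c')).
have oV : open V.
  by apply: open_fwd => //; move/continuousP: cF; apply; exact: openI.
exists V; first by exists x.
apply: (@Ck_on_eq _ _ _ _ (fun u => (f \o bwd c') (\row_i fwd c' (F (bwd c u)) 0 i))) => //.
  move=> _ [y [dy [Wy dFy]] <-] /=; rewrite cK ?inE //; congr (f _).
  rewrite -[RHS]c'K ?inE //; congr (bwd _ _).
  by apply/rowP => i; rewrite mxE.
apply: (@Ck_on_comp _ _ _ _ _ (fwd c' @` (dom c' `&` W)) (f \o bwd c')) => //.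
- exact: open_fwd.
- move=> _ [y [dy [Wy dFy]] <-]; exists (F y) => //; rewrite cK ?inE //.
  by apply/rowP => i; rewrite mxE.
- exact: fW.
move=> j; under eq_fun do rewrite mxE.
by apply: Ck_on_sub (sF c c' Xc Yc' j k) => _ [y [dy [Wy dFy]] <-]; exists y.
Qed.

Lemma smooth_fun_comp (X Y : premanifold R) (F : X -> Y) (f : Y -> R) :
  charted X -> charted Y -> smooth_map F -> smooth_fun f -> smooth_fun (f \o F).
Proof.
move=> cX cY sF sf c Xc.
have := @smooth_comp_local X Y F f setT c cX cY sF openT _ Xc.
rewrite preimage_setT setIT; apply => c' Yc'; rewrite setIT; exact: sf.
Qed.

Lemma smooth_map_comp (X Y Z : premanifold R) (F : X -> Y) (G : Y -> Z) :
  charted X -> charted Y -> charted Z -> smooth_map F -> smooth_map G ->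
  smooth_map (G \o F).
Proof.
move=> cX cY cZ sF [cG sG]; split=> [x|c e Xc Ze i].
  by apply: continuous_comp; [case: sF => + _; apply|exact: cG].
apply: (@smooth_comp_local X Y F (fun y => fwd e (G y) 0 i) (G @^-1` dom e)) => //.
  by move/continuousP: cG; apply; case: cZ => + _ _ => /(_ e Ze)[].
by move=> c' Yc'; exact: sG.
Qed.

Lemma smooth_map_id (X : premanifold R) : charted X -> smooth_map (@idfun X).
Proof. by move=> [_ _ compat]; split=> [x|c c' Xc Xc']; [exact: cvg_id|exact: compat]. Qed.

Lemma smooth_map_cst (X Y : premanifold R) (y : Y) : smooth_map (fun _ : X => y).
Proof.
split=> [x|c c' Xc Yc' i k]; first exact: cst_continuous.
exact: Ck_on_cst.
Qed.

Lemma Ck_on_row_mx m n p k (U : set 'rV[R]_p) (a : 'rV[R]_p -> 'rV[R]_m)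
    (b : 'rV[R]_p -> 'rV[R]_n) i :
  (forall j, Ck_on k U (fun u => a u 0 j)) ->
  (forall j, Ck_on k U (fun u => b u 0 j)) ->
  Ck_on k U (fun u => row_mx (a u) (b u) 0 i).
Proof.
by move=> Ca Cb; under eq_fun do rewrite mxE; case: (fintype.split i) => j.
Qed.

Lemma continuous_row_mx (T : topologicalType) m n (a : T -> 'rV[R]_m)
    (b : T -> 'rV[R]_n) t :
  {for t, continuous a} -> {for t, continuous b} ->
  {for t, continuous (fun x => row_mx (a x) (b x))}.
Proof.
move=> ca cb; apply: continuous_rV_coord => j.
have -> : (fun x => row_mx (a x) (b x) 0 j) =
    fun x => match fintype.split j with inl l => a x 0 l | inr l => b x 0 l end.
  by apply/funext => x; rewrite mxE.
case: (fintype.split j) => l.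
  by apply: (continuous_comp (g := fun v : 'rV[R]_m => v 0 l)) => //; exact: coord_continuous.
by apply: (continuous_comp (g := fun v : 'rV[R]_n => v 0 l)) => //; exact: coord_continuous.
Qed.

Lemma smooth_map_pair (X Y Z : premanifold R) (F : Z -> X) (H : Z -> Y) :
  smooth_map F -> smooth_map H ->
  smooth_map (fun z => (F z, H z) : prodM X Y).
Proof.
move=> [cF sF] [cH sH]; split=> [z|c _ Zc [c1 Xc1 [c2 Yc2 <-]] i k].
  by apply: cvg_pair; [exact: cF|exact: cH].
apply: Ck_on_row_mx => j.
  by apply: Ck_on_sub (sF c c1 Zc Xc1 j k) => _ [z [dz [? ?]] <-]; exists z.
by apply: Ck_on_sub (sH c c2 Zc Yc2 j k) => _ [z [dz [? ?]] <-]; exists z.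
Qed.

Lemma smooth_on_lsubmx m n (V : set 'rV[R]_m) (f : 'rV[R]_m -> R) : open V ->
  smooth_on V f -> smooth_on (@lsubmx R 1 m n @^-1` V) (fun u => f (lsubmx u)).
Proof.
move=> oV sf k; apply: Ck_on_comp (sf k) _ => //.
  by move/continuousP: (@continuous_lsubmx R 1 m n); apply.
by move=> j; under eq_fun do rewrite mxE; exact: Ck_on_coord.
Qed.

Lemma smooth_on_rsubmx m n (V : set 'rV[R]_n) (f : 'rV[R]_n -> R) : open V ->
  smooth_on V f -> smooth_on (@rsubmx R 1 m n @^-1` V) (fun u => f (rsubmx u)).
Proof.
move=> oV sf k; apply: Ck_on_comp (sf k) _ => //.
  by move/continuousP: (@continuous_rsubmx R 1 m n); apply.
by move=> j; under eq_fun do rewrite mxE; exact: Ck_on_coord.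
Qed.

Lemma smooth_map_fst (X Y : premanifold R) : charted X ->
  smooth_map (fun p : prodM X Y => p.1).
Proof.
move=> [aX _ compat]; split=> [p|_ e [c Xc [c' Yc' <-]] Xe i k]; first exact: cvg_fst.
have [odome _ _ _ _] := aX e Xe.
have := smooth_on_lsubmx (mdim Y) (open_fwd (aX c Xc) odome) (compat c e Xc Xe i).
move=> /(_ k); apply: Ck_on_sub => _ [[x y] [/= [dx dy] ex] <-].
by exists x => //=; rewrite row_mxKl.
Qed.

Lemma smooth_map_snd (X Y : premanifold R) : charted Y ->
  smooth_map (fun p : prodM X Y => p.2).
Proof.
move=> [aY _ compat]; split=> [p|_ e [c Xc [c' Yc' <-]] Ye i k]; first exact: cvg_snd.
have [odome _ _ _ _] := aY e Ye.
have := smooth_on_rsubmx (mdim X) (open_fwd (aY c' Yc') odome) (compat c' e Yc' Ye i).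
move=> /(_ k); apply: Ck_on_sub => _ [[x y] [/= [dx dy] ex] <-].
by exists y => //=; rewrite row_mxKr.
Qed.

Lemma chart_axiom_prod (S T : topologicalType) m n (c : chart R S m) (c' : chart R T n) :
  chart_axiom c -> chart_axiom c' -> chart_axiom (prod_chart c c').
Proof.
move=> [od1 oi1 K1 f1 b1] [od2 oi2 K2 f2 b2].
have imgE : img (prod_chart c c') =
    @lsubmx R 1 m n @^-1` img c `&` @rsubmx R 1 m n @^-1` img c'.
  apply/seteqP; split=> [_ [[x y] [/= dx dy] <-]|u [[x dx xu] [y dy yu]]].
    by rewrite row_mxKl row_mxKr; split; [exists x|exists y].
  by exists (x, y) => //=; rewrite xu yu hsubmxK.
split.
- apply: (openI (A := fst @^-1` dom c) (B := snd @^-1` dom c')).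
    by apply: open_comp od1 => p _; exact: cvg_fst.
  by apply: open_comp od2 => p _; exact: cvg_snd.
- rewrite imgE; apply: openI.
    by move/continuousP: (@continuous_lsubmx R 1 m n); apply.
  by move/continuousP: (@continuous_rsubmx R 1 m n); apply.
- by move=> [x y]; rewrite inE => -[/= dx dy]; rewrite row_mxKl row_mxKr K1 ?K2 ?inE.
- move=> [x y] [/= dx dy]; apply: continuous_row_mx.
    by apply: (continuous_comp (f := fst)); [exact: cvg_fst|exact: f1].
  by apply: (continuous_comp (f := snd)); [exact: cvg_snd|exact: f2].
- move=> u; rewrite imgE => -[/= u1 u2].
  have cl : {for u, continuous (fun u => bwd c (@lsubmx R 1 m n u))}.
    by apply: (continuous_comp (g := bwd c)); [exact: continuous_lsubmx|exact: b1].
  have cr : {for u, continuous (fun u => bwd c' (@rsubmx R 1 m n u))}.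
    by apply: (continuous_comp (g := bwd c')); [exact: continuous_rsubmx|exact: b2].
  exact: cvg_pair cl cr.
Qed.

Lemma charted_prod (X Y : premanifold R) :
  charted X -> charted Y -> charted (prodM X Y).
Proof.
move=> cX cY; have [aX coverX _] := cX; have [aY coverY _] := cY; split.
- by move=> _ [c Xc [c' Yc' <-]]; apply: chart_axiom_prod; [exact: aX|exact: aY].
- move=> [x y]; have [c Xc dx] := coverX x; have [c' Yc' dy] := coverY y.
  by exists (prod_chart c c'); [exists c => //; exists c'|split].
- have E : (fun z : prodM X Y => (z.1, z.2) : prodM X Y) = idfun.
    by apply/funext => -[].
  have := smooth_map_pair (smooth_map_fst Y cX) (smooth_map_snd X cY).
  by rewrite E => -[_ sp] c e Pc Pe i k; exact: sp c e Pc Pe i k.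
Qed.

Lemma charted_line : charted (lineM R).
Proof.
have fwd_cont : continuous (fun t : R => \row_(k < 1) t).
  move=> t; apply: continuous_rV_coord => j.
  have -> : (fun x : R => (\row_(k < 1) x) 0 j) = idfun.
    by apply/funext => x; rewrite mxE.
  exact: cvg_id.
split.
- move=> _ ->; split => //=; first exact: openT.
  + have -> : img (Chart [set: R] (fun t : R => \row_(k < 1) t)
        (fun u : 'rV[R]_1 => u 0 0)) = setT; last exact: openT.
      apply/seteqP; split=> // u _; exists (u 0 0) => //.
      by apply/rowP => i; rewrite mxE ord1.
  + by move=> t _; rewrite mxE.
  + by move=> t _; exact: fwd_cont.
  + by move=> u _; exact: coord_continuous.
- by move=> t; eexists; first by [].
- have E (i : 'I_1) :
      (fun u : 'rV[R]_1 => (\row_(k < 1) u 0 0 : 'rV[R]_1) 0 i) = fun u => u 0 0.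
    by apply/funext => u; rewrite mxE.
  move=> _ _ -> -> i k; have := @Ck_on_coord R 1 k setT 0; rewrite -[in X in X -> _](E i).
  by apply: Ck_on_sub => u _.
Qed.

End Charts.

(** * Lie groups *)

Section SmoothFun.
Context {R : realType} {X : manifold R}.
Implicit Types (f g : X -> R).

Let open_img c : atlas X c -> open (img c).
Proof. by move=> Xc; have [aX _ _] := charted_manifold X; case: (aX c Xc). Qed.

Lemma smooth_fun_cst (a : R) : smooth_fun (fun _ : X => a).
Proof. by move=> c Xc k; exact: Ck_on_cst. Qed.

Lemma smooth_fun_add f g :
  smooth_fun f -> smooth_fun g -> smooth_fun (fun p => f p + g p).
Proof.
by move=> sf sg c Xc k; apply: Ck_on_add (open_img Xc) (sf c Xc k) (sg c Xc k).
Qed.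

Lemma smooth_fun_mul f g :
  smooth_fun f -> smooth_fun g -> smooth_fun (fun p => f p * g p).
Proof.
by move=> sf sg c Xc k; apply: Ck_on_mul (open_img Xc) (sf c Xc k) (sg c Xc k).
Qed.

Lemma smooth_fun_scale (a : R) f : smooth_fun f -> smooth_fun (fun p => a * f p).
Proof. by apply: smooth_fun_mul; exact: smooth_fun_cst. Qed.

Lemma smooth_fun_opp f : smooth_fun f -> smooth_fun (fun p => - f p).
Proof. by move=> /(smooth_fun_scale (-1)); under eq_fun do rewrite mulN1r. Qed.

Lemma smooth_fun_sub f g :
  smooth_fun f -> smooth_fun g -> smooth_fun (fun p => f p - g p).
Proof. by move=> sf /smooth_fun_opp; exact: smooth_fun_add. Qed.

Lemma smooth_fun_sum (I : Type) (r : seq I) (F : I -> X -> R) :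
  (forall i, smooth_fun (F i)) -> smooth_fun (fun p => \sum_(i <- r) F i p).
Proof.
move=> sF; elim: r => [|i r IH].
  by under eq_fun do rewrite big_nil; exact: smooth_fun_cst.
by under eq_fun do rewrite big_cons; apply: smooth_fun_add.
Qed.

Section Tangent.
Context {p : X} {u : (X -> R) -> R} (tu : tangent p u).

Lemma tangentD f g : smooth_fun f -> smooth_fun g ->
  u (fun q => f q + g q) = u f + u g.
Proof.
move=> sf sg; have [/(_ 1) + _] := tu sf sg; rewrite mul1r => <-.
by congr u; apply/funext => q; rewrite mul1r.
Qed.

Lemma tangent0 : u (fun=> 0) = 0.
Proof.
have s0 := smooth_fun_cst 0; have := tangentD s0 s0.
have -> : (fun q : X => 0 + 0 : R) = fun=> 0 by apply/funext => q; rewrite addr0.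
by move=> /eqP; rewrite -subr_eq0 opprD addrA subrr sub0r oppr_eq0 => /eqP.
Qed.

Lemma tangentZ (a : R) f : smooth_fun f -> u (fun q => a * f q) = a * u f.
Proof.
move=> sf; have [/(_ a) + _] := tu sf (smooth_fun_cst 0); rewrite tangent0 addr0 => <-.
by congr u; apply/funext => q; rewrite addr0.
Qed.

Lemma tangentN f : smooth_fun f -> u (fun q => - f q) = - u f.
Proof.
move=> sf; rewrite -mulN1r -tangentZ //.
by congr u; apply/funext => q; rewrite mulN1r.
Qed.

Lemma tangentB f g : smooth_fun f -> smooth_fun g ->
  u (fun q => f q - g q) = u f - u g.
Proof. by move=> sf sg; rewrite tangentD ?tangentN //; exact: smooth_fun_opp. Qed.

Lemma tangentM f g : smooth_fun f -> smooth_fun g ->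
  u (fun q => f q * g q) = u f * g p + f p * u g.
Proof. by move=> sf sg; case: (tu sf sg). Qed.

Lemma tangent_sum (I : Type) (r : seq I) (F : I -> X -> R) :
  (forall i, smooth_fun (F i)) ->
  u (fun q => \sum_(i <- r) F i q) = \sum_(i <- r) u (F i).
Proof.
move=> sF; elim: r => [|i r IH].
  by rewrite big_nil -[RHS]tangent0; congr u; apply/funext => q; rewrite big_nil.
rewrite big_cons -IH -tangentD //; last exact: smooth_fun_sum.
by congr u; apply/funext => q; rewrite big_cons.
Qed.

End Tangent.
End SmoothFun.

Section LieGroup.
Context {R : realType} {G : lieGroup R}.
Implicit Types (a b c : G) (f : G -> R).

Lemma mulgV a : mul a (inv a) = one.
Proof.
by rewrite -(mul1 (mul a _)) -{1}(mulV (inv a)) -mulA (mulA (inv a)) mulV mul1 mulV.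
Qed.

Lemma mulg1 a : mul a one = a.
Proof. by rewrite -(mulV a) mulA mulgV mul1. Qed.

Lemma idempotent_one a : mul a a = a -> a = one.
Proof. by move=> aa; rewrite -(mulV a) -{3}aa mulA mulV mul1. Qed.

Lemma smooth_fun_mull a f : smooth_fun f -> smooth_fun (f \o mul a).
Proof.
have cG := charted_manifold G.
apply: (smooth_fun_comp cG cG).
apply: (smooth_map_comp (Y := prodM G G) (F := fun b => (a, b)) cG _ cG _ (mul_smooth G)).
  exact: charted_prod.
apply: smooth_map_pair; [exact: smooth_map_cst|exact: smooth_map_id].
Qed.

Context (g : lieAlgebra G).
Implicit Types (x y z : g).

Lemma linv_tangent x p : tangent p (fun f => linv x f p).
Proof. by have [[_ tx] _] := linvP x. Qed.

Lemma linv_smooth x f : smooth_fun f -> smooth_fun (linv x f).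
Proof. by have [[sx _] _] := linvP x; exact: sx. Qed.

Lemma linv_mul x f a b : smooth_fun f -> linv x f (mul a b) = linv x (f \o mul a) b.
Proof. by move=> sf; have [_ lx] := linvP x; rewrite lx. Qed.

Lemma linvE x f a : smooth_fun f -> linv x f a = linv x (f \o mul a) one.
Proof. by move=> sf; rewrite -linv_mul // mulg1. Qed.

Lemma linvZ (a : R) x f p : smooth_fun f -> linv (a *: x) f p = a * linv x f p.
Proof.
move=> sf; have l0 : linv (0 : g) f p = 0.
  have := linv_linear 1 (0 : g) 0 p sf; rewrite scale1r addr0 mul1r.
  by move=> /eqP; rewrite -subr_eq0 opprD addrA subrr sub0r oppr_eq0 => /eqP.
by rewrite -[a *: x]addr0 linv_linear // l0 addr0.
Qed.

Lemma linvB x y f p : smooth_fun f -> linv (x - y) f p = linv x f p - linv y f p.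
Proof. by move=> sf; rewrite addrC -scaleN1r linv_linear // mulN1r addrC. Qed.

Lemma linv_eq x y : (forall f, smooth_fun f -> linv x f one = linv y f one) -> x = y.
Proof.
move=> xy; apply/eqP; rewrite -subr_eq0; apply/eqP/linv_inj => f b sf.
have sfb := smooth_fun_mull b sf.
by rewrite linvB // !(linvE _ b) // xy // subrr.
Qed.

Lemma bracket_anti x y : bracket x y = - bracket y x.
Proof.
apply: linv_eq => f sf; rewrite -scaleN1r linvZ // !linv_bracket //; ring.
Qed.

Lemma bracket_linear_r (a : R) x y z :
  bracket x (a *: y + z) = a *: bracket x y + bracket x z.
Proof.
apply: linv_eq => f sf; have sy := linv_smooth y sf; have sz := linv_smooth z sf.
rewrite linv_linear // !linv_bracket // !linv_linear //; try exact: linv_smooth.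
have -> : linv (a *: y + z) f = fun p => a * linv y f p + linv z f p.
  by apply/funext => p; rewrite linv_linear.
have [+ _] := linv_tangent x one sy sz => ->; ring.
Qed.

Lemma bracket_linear_l (a : R) x y z :
  bracket (a *: x + y) z = a *: bracket x z + bracket y z.
Proof.
by rewrite bracket_anti bracket_linear_r opprD -scalerN -!(bracket_anti _ z).
Qed.

End LieGroup.

Section LieMorphism.
Context {R : realType} {D G : lieGroup R} {d : lieAlgebra D} {g : lieAlgebra G}.
Context {iota : G -> D}.
Context {i : 'Hom(g, d)} (sub : connected_closed_subgroup iota)
  (di : lie_differential iota i).

Let cG := charted_manifold G.
Let cD := charted_manifold D.

Let smooth_iota f : smooth_fun f -> smooth_fun (f \o iota).
Proof. by have [[_ si _ _ _] _] := sub; exact: smooth_fun_comp. Qed.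

Let iotaM : {morph iota : a b / mul a b >-> mul a b}.
Proof. by case: sub => [[]]. Qed.

Lemma linv_iota (x : g) (f : D -> R) b : smooth_fun f ->
  linv (i x) f (iota b) = linv x (f \o iota) b.
Proof.
move=> sf; rewrite linvE // di; last exact: smooth_fun_mull.
rewrite (linvE _ b); last exact: smooth_iota.
by congr (linv x _ one); apply/funext => a /=; rewrite iotaM.
Qed.

Lemma differential_inj : injective i.
Proof.
move=> x y xy; have [_ [_ imm]] := sub; apply: linv_eq => f sf.
apply/eqP; rewrite -subr_eq0 -linvB //; apply/eqP.
apply: imm (linv_tangent (x - y) one) _ f sf => f0 sf0.
by rewrite -di // linearB /= xy subrr -(scale0r 0) linvZ // mul0r.
Qed.

Lemma differential_bracket (x y : g) : i (bracket x y) = bracket (i x) (i y).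
Proof.
have iota1 : iota one = one by apply: idempotent_one; rewrite -iotaM mul1.
apply: linv_eq => f sf; rewrite -{1}iota1 linv_iota // !linv_bracket //; last first.
  exact: smooth_iota.
have sl (z : g) : linv (i z) f \o iota = linv z (f \o iota).
  by apply/funext => b /=; rewrite linv_iota.
by rewrite -iota1 !linv_iota ?sl //; exact: linv_smooth.
Qed.

End LieMorphism.

(** * Smooth actions *)

Section LineFamilies.
Context {R : realType}.

Let e0 n : 'rV[R]_(1 + n) := delta_mx 0 (lshift n 0).

Let row_mx_line n (s : R) (u : 'rV[R]_n) :
  row_mx (0 : 'rV[R]_1) u + s *: e0 n = row_mx (\row__ s) u.
Proof.
apply/rowP => j; rewrite !mxE; case: (splitP j) => k jk.
  have -> : j = lshift n k by exact: val_inj.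
  by rewrite !ord1 !mxE eqxx mulr1 add0r.
have -> : j = rshift 1 k by exact: val_inj.
by rewrite mulr0 addr0.
Qed.

Lemma smooth_derive_line (X : manifold R) (K : prodM (lineM R) X -> R) :
  smooth_fun K ->
  (forall p, derivable (fun t : R => K (t, p)) 0 1) /\
  smooth_fun (fun p => 'D_1 (fun t : R => K (t, p)) 0).
Proof.
move=> sK; have [aX coverX _] := charted_manifold X.
pose l := Chart setT (fun t : R => \row_(k < 1) t) (fun u : 'rV[R]_1 => u 0 0).
have dK c u : atlas X c -> img c u ->
    is_derive (0 : R) (1 : R) (fun t : R => K (t, bwd c u))
      ('D_(e0 (mdim X)) (K \o bwd (prod_chart l c)) (row_mx 0 u)).
  move=> Xc cu; set f := K \o _.
  have -> : (fun t : R => K (t, bwd c u)) =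
      (fun s : R => f (row_mx 0 u + s *: e0 (mdim X))).
    by apply/funext => s; rewrite row_mx_line /f /= row_mxKl row_mxKr mxE.
  rewrite -[X in 'D_(e0 _) f X]addr0 -(scale0r (e0 (mdim X))).
  apply: is_derive_line; rewrite scale0r addr0.
  have := sK (prod_chart l c) _ 1; case=> [|_ /(_ (lshift _ 0)) [+ _]].
    by exists l => //; exists c.
  apply; have [x dx xu] := cu; exists (0, x) => //=.
  by rewrite -xu; congr row_mx; apply/rowP => j; rewrite !mxE.
split=> [p|c Xc k].
  have [c Xc dp] := coverX p; have [_ _ cK _ _] := aX c Xc.
  have ip : img c (fwd c p) by exists p.
  by have [+ _] := dK c (fwd c p) Xc ip; rewrite cK ?inE.
have oic : open (img c) by case: (aX c Xc).
have oil : open (img (prod_chart l c)).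
  by have [aP _ _] := charted_prod (charted_line (R := R)) (charted_manifold X);
     case: (aP (prod_chart l c)) => //; exists l => //; exists c.
apply: (@Ck_on_eq _ _ _ _ (fun u => (fun v => 'D_(e0 (mdim X))
    (K \o bwd (prod_chart l c)) v) (row_mx 0 u))) => //.
  by move=> u cu /=; have [_ ->] := dK c u Xc cu.
apply: (@Ck_on_comp _ _ _ _ _ (img (prod_chart l c))
  (fun v => 'D_(e0 (mdim X)) (K \o bwd (prod_chart l c)) v)) => //.
- move=> u [x dx xu]; exists (0, x) => //=.
  by rewrite -xu; congr row_mx; apply/rowP => j; rewrite !mxE.
- have := sK (prod_chart l c) _ k.+1; case=> [|_ /(_ (lshift _ 0)) [_]] //.
  by exists l => //; exists c.
- by move=> j; apply: Ck_on_row_mx => i; [exact: Ck_on_cst|exact: Ck_on_coord].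
Qed.

Lemma schwarz_line (K : prodM (lineM R) (lineM R) -> R) : smooth_fun K ->
  'D_1 (fun s : R => 'D_1 (fun t : R => K (s, t)) 0) (0 : R) =
  'D_1 (fun t : R => 'D_1 (fun s : R => K (s, t)) 0) (0 : R).
Proof.
move=> sK.
pose l := Chart setT (fun t : R => \row_(k < 1) t) (fun u : 'rV[R]_1 => u 0 0).
pose f := K \o bwd (prod_chart l l).
have sf k : Ck_on k setT f.
  have := sK (prod_chart l l) _ k; have -> : img (prod_chart l l) = setT; last first.
    by apply; exists l => //; exists l.
  apply/seteqP; split=> // u _; exists (u 0 (lshift 1 0), u 0 (rshift 1 0)) => //=.
  apply/rowP => j; rewrite mxE; case: (splitP j) => m jm; rewrite mxE ord1 in jm *;
    by congr (u 0 _); exact: val_inj.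
pose a : 'I_(1 + 1) := lshift 1 0; pose b : 'I_(1 + 1) := rshift 1 0.
pose ea : 'rV[R]_(1 + 1) := delta_mx 0 a; pose eb : 'rV[R]_(1 + 1) := delta_mx 0 b.
have fpt s t : f (s *: ea + t *: eb) = K (s, t).
  by rewrite /f /= !mxE !eqxx /= !mulr1 !mulr0 addr0 add0r.
pose fa (u : 'rV[R]_(1 + 1)) : R := 'D_ea f u.
pose fb (u : 'rV[R]_(1 + 1)) : R := 'D_eb f u.
have S : 'D_ea fb 0 = 'D_eb fa 0 by exact: schwarz a b openT (sf 2) I.
have [_ df] := sf 2.
have da u : derivable f u ea by have [H _] := df a; exact: (H u I).
have db u : derivable f u eb by have [H _] := df b; exact: (H u I).
have dab u : derivable fa u eb by have [_ [_ /(_ b)[H _]]] := df a; exact: (H u I).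
have dba u : derivable fb u ea by have [_ [_ /(_ a)[H _]]] := df b; exact: (H u I).
have D1 s : 'D_1 (fun t : R => K (s, t)) 0 = fb (0 + s *: ea).
  have -> : (fun t : R => K (s, t)) = fun t : R => f (s *: ea + t *: eb).
    by apply/funext => t; rewrite -fpt.
  have [_ E] := is_derive_line (db (s *: ea + 0 *: eb)).
  by rewrite E /fb scale0r addr0 add0r.
have D2 t : 'D_1 (fun s : R => K (s, t)) 0 = fa (0 + t *: eb).
  have -> : (fun s : R => K (s, t)) = fun s : R => f (t *: eb + s *: ea).
    by apply/funext => s; rewrite -fpt addrC.
  have [_ E] := is_derive_line (da (t *: eb + 0 *: ea)).
  by rewrite E /fa scale0r addr0 add0r.
clearbody fa fb.
have [_ Ea] := is_derive_line (dba (0 + 0 *: ea)).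
have [_ Eb] := is_derive_line (dab (0 + 0 *: eb)).
rewrite !scale0r !addr0 in Ea Eb.
by rewrite (funext D1) (funext D2) [LHS]Ea [RHS]Eb.
Qed.

End LineFamilies.

Section Orbits.
Context {R : realType} {G : lieGroup R} {g : lieAlgebra G} {expG : g -> G}.
Context (expP : exponential expG).
Context {M : manifold R} {act : G -> M -> M} (actP : smooth_action act).
Implicit Types (x y : g) (f : M -> R) (m : M).

Let cG := charted_manifold G.
Let cM := charted_manifold M.
Let cL := charted_line (R := R).

Lemma smooth_fun_orbit f m : smooth_fun f -> smooth_fun (fun a => f (act a m)).
Proof.
have [sact _ _] := actP; apply: smooth_fun_comp => //.
apply: (smooth_map_comp (Y := prodM G M) (F := fun b => (b, m)) cG _ cM _ sact).
  exact: charted_prod.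
by apply: smooth_map_pair; [exact: smooth_map_id|exact: smooth_map_cst].
Qed.

Lemma smooth_fun_flow x f : smooth_fun f ->
  smooth_fun (fun p : prodM (lineM R) M => f (act (expG (p.1 *: x)) p.2)).
Proof.
have [sact _ _] := actP; have [sexp _ _] := expP x.
have cLM := charted_prod cL cM.
apply: smooth_fun_comp => //.
apply: (smooth_map_comp (Y := prodM G M)
  (F := fun p : prodM (lineM R) M => (expG (p.1 *: x), p.2)) cLM _ cM _ sact).
  exact: charted_prod.
apply: smooth_map_pair; last exact: smooth_map_snd.
apply: (smooth_map_comp (F := fun p : prodM (lineM R) M => p.1) cLM cL cG _ sexp).
exact: smooth_map_fst.
Qed.

Lemma fundE x f m : smooth_fun f ->
  fund expG act x f m = - linv x (fun a => f (act a m)) one.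
Proof.
move=> sf; have [_ _ /(_ _ (smooth_fun_orbit m sf)) de] := expP x.
rewrite /fund derive1E; set k := fun t : R => _ in de.
have dk : is_derive (- 0 : R) (1 : R) k (linv x (fun a => f (act a m)) one).
  by rewrite oppr0.
have := is_derive1_comp dk (is_deriveNid (0 : R) (1 : R)) => -[_].
by rewrite mulrN1 => <-.
Qed.

Lemma linv_orbitE x f m : smooth_fun f ->
  linv x (fun a => f (act a m)) one = 'D_1 (fun t : R => f (act (expG (t *: x)) m)) 0.
Proof.
by move=> sf; have [_ _ /(_ _ (smooth_fun_orbit m sf)) [_ ->]] := expP x.
Qed.

Lemma fund_vector_field x : vector_field (fund expG act x).
Proof.
have [_ act1 _] := actP; split=> [f sf|m f h sf sh].
  have -> : fund expG act x f = fun m => - 'D_1 (fun t : R => f (act (expG (t *: x)) m)) 0.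
    by apply/funext => m; rewrite fundE // linv_orbitE.
  apply: smooth_fun_opp.
  by have [_] := smooth_derive_line (smooth_fun_flow x sf).
have tx := linv_tangent x (one : G).
have so := smooth_fun_orbit m sf; have oh := smooth_fun_orbit m sh.
split=> [a|].
  rewrite !fundE //; last by apply: smooth_fun_add => //; exact: smooth_fun_scale.
  have [+ _] := tx _ _ so oh => ->; ring.
rewrite !fundE //; last exact: smooth_fun_mul.
rewrite (tangentM tx) // act1; ring.
Qed.

Lemma fund_linear (a : R) x y f m : smooth_fun f ->
  fund expG act (a *: x + y) f m = a * fund expG act x f m + fund expG act y f m.
Proof.
move=> sf; rewrite !fundE // linv_linear; first ring.
exact: smooth_fun_orbit.
Qed.

End Orbits.

Section FundBracket.
Context {R : realType} {G : lieGroup R} {g : lieAlgebra G} {expG : g -> G}.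
Context (expP : exponential expG).
Implicit Types (x y : g).

Let cG := charted_manifold G.

Lemma mul_smooth_action : smooth_action (mul : G -> G -> G).
Proof. by split; [exact: mul_smooth|exact: mul1|move=> a b c; rewrite mulA]. Qed.

(* The inner expression is the right-invariant field with value [y] at [one], which
   commutes with the left-invariant field [linv x]. *)
Lemma linv_exchange x y (phi : G -> R) : smooth_fun phi ->
  linv x (fun a => linv y (fun b => phi (mul b a)) one) one =
  linv y (linv x phi) one.
Proof.
move=> sphi; have aG := mul_smooth_action.
have sy : smooth_fun (fun a => linv y (fun b => phi (mul b a)) one).
  have [sfund _] := fund_vector_field expP aG y.
  have := smooth_fun_opp (sfund _ sphi).
  by under eq_fun do rewrite (fundE expP aG) // opprK.
have sK : smooth_fun (fun p : prodM (lineM R) (lineM R) =>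
    phi (mul (expG (p.2 *: y)) (expG (p.1 *: x)))).
  have cL := charted_line (R := R); have cLL := charted_prod cL cL.
  have [sx _ _] := expP x; have [sey _ _] := expP y.
  apply: smooth_fun_comp => //.
  apply: (smooth_map_comp (Y := prodM G G) (F := fun p : prodM (lineM R) (lineM R) =>
    (expG (p.2 *: y), expG (p.1 *: x))) cLL _ cG _ (mul_smooth G)).
    exact: charted_prod.
  apply: smooth_map_pair.
    apply: (smooth_map_comp (F := fun p : prodM (lineM R) (lineM R) => p.2) cLL cL cG _ sey).
    exact: smooth_map_snd.
  apply: (smooth_map_comp (F := fun p : prodM (lineM R) (lineM R) => p.1) cLL cL cG _ sx).
  exact: smooth_map_fst.
have sxphi := linv_smooth x sphi.
have [_ _ /(_ _ sy) [_ <-]] := expP x; have [_ _ /(_ _ sxphi) [_ <-]] := expP y.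
transitivity ('D_1 (fun s : R => 'D_1 (fun t : R =>
    phi (mul (expG (t *: y)) (expG (s *: x)))) 0) (0 : R)).
  by congr derive; apply/funext => s; rewrite (linv_orbitE expP aG).
rewrite (schwarz_line sK); congr derive; apply/funext => t /=.
rewrite linvE //; have [_ _ H] := expP x.
by have [_ <-] := H _ (smooth_fun_mull (expG (t *: y)) sphi).
Qed.

Context {M : manifold R} {act : G -> M -> M} (actP : smooth_action act).

Lemma fund_bracket x y (f : M -> R) m : smooth_fun f ->
  fund expG act (bracket x y) f m =
  fund expG act x (fund expG act y f) m - fund expG act y (fund expG act x f) m.
Proof.
move=> sf; have sfm := smooth_fun_orbit actP m sf.
have [_ act1 actM] := actP.
have main z w : fund expG act z (fund expG act w f) m =
    linv w (linv z (fun a => f (act a m))) one.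
  have [sw _] := fund_vector_field expP actP w.
  rewrite (fundE expP actP) //; last exact: sw.
  rewrite -(linv_exchange z w sfm).
  have s1 := smooth_fun_orbit actP m (sw f sf).
  rewrite -(tangentN (linv_tangent z one) s1); congr (linv z _ one).
  apply/funext => a; rewrite (fundE expP actP) // opprK.
  by congr (linv w _ one); apply/funext => b; rewrite actM.
by rewrite !main (fundE expP actP) // linv_bracket // opprB.
Qed.

End FundBracket.

(** * Isotropic complements and twists *)

Lemma linfun_exists (R : realType) (V W : vectType R) (f : V -> W) :
  linear f -> exists F : 'Hom(V, W), F =1 f.
Proof.
move=> lf; pose F : {linear V -> W} :=
  HB.pack f (GRing.isLinear.Build R V W *:%R f lf).
by exists (linfun F) => x; rewrite lfunE.
Qed.

Section Scalar.
Context {R : realType} {V : vectType R} {a : V -> R}.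
Context (la : forall (c : R) y z, a (c *: y + z) = c * a y + a z).

Lemma scalar_form0 : a 0 = 0.
Proof.
have := la 1 0 0; rewrite scale1r addr0 mul1r => /eqP.
by rewrite -subr_eq0 opprD addrA subrr sub0r oppr_eq0 => /eqP.
Qed.

Lemma scalar_form_sum n (c : 'I_n -> R) (v : 'I_n -> V) :
  a (\sum_k c k *: v k) = \sum_k c k * a (v k).
Proof.
elim/big_rec2: _ => [|k z w _ IH]; first exact: scalar_form0.
by rewrite la IH.
Qed.

Lemma scalar_form_coord y :
  a y = \sum_k coord (vbasis {:V}) k y * a (vbasis {:V})`_k.
Proof. by rewrite {1}(coord_vbasis (memvf y)) scalar_form_sum. Qed.

End Scalar.

Section ComplementTheory.
Context {R : realType} {d g : vectType R} {br : d -> d -> d} {B : d -> d -> R}.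
Context {brg : g -> g -> g} {i : 'Hom(g, d)}.
Context (Bl : forall (a : R) x y z, B (a *: x + y) z = a * B x z + B y z).
Context (Bsym : forall x y, B x y = B y x).
Context (Bnd : forall x, (forall y, B x y = 0) -> x = 0).
Context (iinj : injective i) (giso : isotropic B (limg i)).

Let Br (a : R) x y z : B x (a *: y + z) = a * B x y + B x z.
Proof. by rewrite Bsym Bl !(Bsym _ x). Qed.

Let BDl x y z : B (x + y) z = B x z + B y z.
Proof. by rewrite -[x]scale1r Bl mul1r scale1r. Qed.

Let BDr x y z : B x (y + z) = B x y + B x z.
Proof. by rewrite !(Bsym x) BDl. Qed.

Let BBl x y z : B (x - y) z = B x z - B y z.
Proof. by rewrite addrC -scaleN1r Bl mulN1r addrC. Qed.

Let Bii x y : B (i x) (i y) = 0.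
Proof. by apply: giso; rewrite memv_img // memvf. Qed.

Section OneComplement.
Context {h : {vspace d}} (hC : isotropic_complement B (limg i) h).

Let hiso x y : x \in h -> y \in h -> B x y = 0.
Proof. by case: hC => H _ _; exact: H. Qed.

Let proj_gE z : z = i (proj_g i h z) + proj_h i h z.
Proof.
have [_ Uh Uh0] := hC; have zUh : z \in (limg i + h)%VS by rewrite Uh memvf.
by rewrite /proj_g limg_lfunVK ?memv_pi // /proj_h daddv_pi_add.
Qed.

Let decomp z : exists2 x, z = i x + proj_h i h z & proj_h i h z \in h.
Proof. by exists (proj_g i h z); [exact: proj_gE|exact: memv_pi]. Qed.

Let perp z : (forall x, B z (i x) = 0) -> z \in h -> z = 0.
Proof.
move=> zi zh; apply: Bnd => y; have [x yE yh] := decomp y.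
by rewrite yE BDr zi add0r hiso.
Qed.

Let form_exists z : exists F : 'Hom(g, R^o), forall x, F x = B z (i x).
Proof. by apply: linfun_exists => a x y; rewrite linearD linearZ Br. Qed.

Lemma jmap_exists (xi : 'Hom(g, R^o)) :
  exists z, z \in h /\ forall x, B z (i x) = xi x.
Proof.
pose N := \dim {:g}; pose e (k : 'I_N) : g := (vbasis {:g})`_k.
pose K := \dim h; pose b (k : 'I_K) : d := (vbasis h)`_k.
have [L LE] : exists L : 'Hom(d, 'rV[R]_N), forall z, L z = \row_k B z (i (e k)).
  by apply: linfun_exists => a x y; apply/rowP => k; rewrite !mxE Bl.
have [T TE] : exists T : 'Hom(g, 'rV[R]_K), forall x, T x = \row_k B (b k) (i x).
  apply: linfun_exists => a x y; apply/rowP => k.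
  by rewrite !mxE linearD linearZ Br.
have BzE z x : B z (i x) = \sum_k coord (vbasis {:g}) k x * B z (i (e k)).
  rewrite (@scalar_form_coord _ _ (fun x => B z (i x))) // => c y w.
  by rewrite linearD linearZ Br.
have dimL : \dim (L @: h)%VS = K.
  apply: limg_dim_eq; apply/eqP; rewrite -subv0; apply/subvP => z.
  rewrite memv_cap memv_ker LE memv0 => /andP[zh /eqP/rowP Lz].
  apply/eqP/perp => // x; rewrite BzE big1 // => k _.
  by have := Lz k; rewrite !mxE => ->; rewrite mulr0.
have dimT : \dim (T @: {:g})%VS = N.
  apply: limg_dim_eq; apply/eqP; rewrite -subv0; apply/subvP => x.
  rewrite memv_cap memv_ker TE memv0 => /andP[_ /eqP/rowP Tx].
  suff ix0 : i x = 0 by apply/eqP/iinj; rewrite ix0 linear0.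
  apply: Bnd => y; have [w yE yh] := decomp y.
  rewrite yE BDr Bii add0r Bsym (coord_vbasis yh).
  rewrite (@scalar_form_sum _ _ (B ^~ (i x))) => [|c u v]; last exact: Bl.
  by rewrite big1 // => k _; have := Tx k; rewrite !mxE => ->; rewrite mulr0.
have LK : (L @: h)%VS = fullv.
  apply/eqP; rewrite eqEdim subvf /= dimL dimvf /dim /= mul1n -dimT.
  by rewrite (leq_trans (dimvS (subvf _))) // dimvf /dim /= mul1n.
have : \row_k xi (e k) \in (L @: h)%VS by rewrite LK memvf.
move=> /memv_imgP[z zh]; rewrite LE => /rowP zE; exists z; split=> // x.
rewrite BzE (@scalar_form_coord _ _ xi) => [|c y w]; last by rewrite linearP.
by apply: eq_bigr => k _; have := zE k; rewrite !mxE => ->.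
Qed.

Lemma jmap_in xi : jmap B i h xi \in h.
Proof. by have [] := xgetPex 0 (jmap_exists xi). Qed.

Lemma jmapE xi x : B (jmap B i h xi) (i x) = xi x.
Proof. by have [_ ->] := xgetPex 0 (jmap_exists xi). Qed.

Lemma jmap_invE z x : z \in h -> jmap_inv B i h z x = B z (i x).
Proof.
move=> zh; have [F FE] := form_exists z.
have ex : exists xi, jmap B i h xi = z.
  exists F; apply/eqP; rewrite -subr_eq0; apply/eqP/perp => [y|].
    by rewrite BBl jmapE FE subrr.
  by rewrite memvB // jmap_in.
by rewrite -[in RHS](xgetPex 0 ex) jmapE.
Qed.

Lemma FtensorE x xi eta :
  Ftensor br B i h x xi eta = B (br (jmap B i h xi) (jmap B i h eta)) (i x).
Proof.
set z := br _ _; have [y zE zh] := decomp z.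
by rewrite /Ftensor jmap_invE // [in RHS]zE BDl Bii add0r.
Qed.

Lemma phitensorE xi eta zeta :
  phitensor br B i h xi eta zeta =
  B (br (jmap B i h xi) (jmap B i h eta)) (jmap B i h zeta).
Proof.
set z := br _ _; have [y _ zh] := decomp z.
by rewrite [in RHS](proj_gE z) BDl (hiso zh (jmap_in _)) addr0 Bsym jmapE.
Qed.

End OneComplement.

Section Twist.
Context {h h' : {vspace d}}.
Context (hC : isotropic_complement B (limg i) h).
Context (hC' : isotropic_complement B (limg i) h').

Let j := jmap B i h.
Let j' := jmap B i h'.
Let t := twist B i h h'.

Lemma twistE xi : j' xi = j xi + i (t xi).
Proof.
have z0 x : B (j' xi - j xi) (i x) = 0.
  by rewrite BBl (jmapE hC') (jmapE hC) subrr.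
rewrite /t /twist limg_lfunVK ?(addrC (j xi)) ?subrK //.
have [_ Uh _] := hC; have : j' xi - j xi \in (limg i + h)%VS by rewrite Uh memvf.
move=> /memv_addP[u ug [v vh E]]; rewrite -/j -/j' E.
have -> : v = 0; last by rewrite addr0.
have [/memv_imgP[w _ uE]] := ug.
apply: Bnd => y.
have /memv_addP[_ /memv_imgP[x _ ->] [y' y'h ->]] : y \in (limg i + h)%VS.
  by rewrite Uh memvf.
rewrite BDr; have -> : v = (j' xi - j xi) - u by rewrite E (addrC u) addrK.
rewrite BBl z0 uE Bii subr0 add0r.
have -> : j' xi - j xi - i w = v by rewrite E uE (addrC (i w)) addrK.
by case: hC => iso _ _; apply: iso.
Qed.

Lemma twist_tensor_anti xi eta :
  twist_tensor B i h h' xi eta = - twist_tensor B i h h' eta xi.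
Proof.
have [iso _ _] := hC; have [iso' _ _] := hC'.
rewrite /twist_tensor -(jmapE hC eta) -(jmapE hC' xi) -/t -/j -/j'.
have j'B zeta z : B z (i (t zeta)) = B z (j' zeta) - B z (j zeta).
  by rewrite twistE BDr addrAC subrr add0r.
rewrite !j'B (iso _ _ (jmap_in hC _) (jmap_in hC _)).
by rewrite (iso' _ _ (jmap_in hC' _) (jmap_in hC' _)) subr0 sub0r opprK Bsym.
Qed.

Context (brDl : forall x y z, br (x + y) z = br x z + br y z).
Context (brDr : forall x y z, br x (y + z) = br x y + br x z).
Context (br_anti : forall x y, br x y = - br y x).
Context (Binv : forall x y z, B (br x y) z = B x (br y z)).
Context (ibr : forall x y, i (brg x y) = br (i x) (i y)).

Let brg_anti x y : brg x y = - brg y x.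
Proof. by apply: iinj; rewrite linearN /= !ibr; exact: br_anti. Qed.

Let BNl x y : B (- x) y = - B x y.
Proof. by have := BBl 0 x y; rewrite sub0r -[B 0 y](addrK (B 0 y)) -BDl addr0 subrr sub0r. Qed.

Lemma Ftensor_twist x xi eta :
  Ftensor br B i h' x xi eta =
  Ftensor br B i h x xi eta + eta (brg x (t xi)) - xi (brg x (t eta)).
Proof.
rewrite (FtensorE hC) (FtensorE hC') -/j -/j' !twistE !(brDl, brDr, BDl).
rewrite -ibr Bii addr0 (br_anti (i _) (j _)) BNl !Binv -!ibr /j !(jmapE hC).
rewrite !(brg_anti _ x) !linearN opprK -/j; ring.
Qed.

Lemma phitensor_twist xi eta zeta :
  phitensor br B i h' xi eta zeta = phitensor br B i h xi eta zeta
  + (Ftensor br B i h (t zeta) xi eta + Ftensor br B i h (t xi) eta zeta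
     + Ftensor br B i h (t eta) zeta xi)
  + (zeta (brg (t xi) (t eta)) + xi (brg (t eta) (t zeta)) + eta (brg (t zeta) (t xi))).
Proof.
rewrite !(FtensorE hC) (phitensorE hC) (phitensorE hC') -/j -/j' !twistE.
rewrite !(brDl, brDr, BDl, BDr) -!ibr Bii.
have -> : B (i (brg (t xi) (t eta))) (j zeta) = zeta (brg (t xi) (t eta)).
  by rewrite Bsym jmapE.
have -> : B (br (j xi) (i (t eta))) (j zeta) = B (br (j zeta) (j xi)) (i (t eta)).
  by rewrite Bsym Binv.
have -> : B (br (i (t xi)) (j eta)) (j zeta) = B (br (j eta) (j zeta)) (i (t xi)).
  by rewrite Binv Bsym.
have -> : B (br (j xi) (i (t eta))) (i (t zeta)) = xi (brg (t eta) (t zeta)).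
  by rewrite Binv -ibr jmapE.
have -> : B (br (i (t xi)) (j eta)) (i (t zeta)) = eta (brg (t zeta) (t xi)).
  by rewrite br_anti BNl Binv -ibr jmapE // brg_anti linearN opprK.
ring.
Qed.

End Twist.
End ComplementTheory.

(** * The twisted bivector *)

Section TwistedAction.
Context {R : realType} {g : vectType R} {br : g -> g -> g} {M : manifold R}.
Context (br_lin : forall (c : R) x y z, br x (c *: y + z) = c *: br x y + br x z).
Context {fd : g -> (M -> R) -> M -> R} (fd_vf : forall x, vector_field (fd x)).
Context (fd_lin : forall (c : R) x y f m, smooth_fun f ->
  fd (c *: x + y) f m = c * fd x f m + fd y f m).
Context (fd_br : forall x y f m, smooth_fun f ->
  fd (br x y) f m = fd x (fd y f) m - fd y (fd x f) m).
Context {N : nat} {e : 'I_N -> g} {eps : 'I_N -> 'Hom(g, R^o)}.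
Context (e_basis : forall y, y = \sum_k eps k y *: e k).
Context {t : 'Hom(g, R^o) -> g}.
Context (t_anti : forall xi eta : 'Hom(g, R^o), eta (t xi) = - xi (t eta)).

Let form2 (T : 'Hom(g, R^o) -> 'Hom(g, R^o) -> R) f h m : R :=
  \sum_k \sum_l T (eps k) (eps l) * (fd (e k) f m * fd (e l) h m).
Let form3 (T : 'Hom(g, R^o) -> 'Hom(g, R^o) -> 'Hom(g, R^o) -> R) f h l m : R :=
  \sum_k \sum_n \sum_p T (eps k) (eps n) (eps p) *
    (fd (e k) f m * fd (e n) h m * fd (e p) l m).

Let u k := t (eps k).
Let X k := fd (e k).
Let Y k := fd (u k).
Let tM := form2 (fun xi eta => eta (t xi)).

Let scalar_form (a : g -> R) := forall (c : R) y z, a (c *: y + z) = c * a y + a z.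

Let expand a y : scalar_form a -> a y = \sum_k eps k y * a (e k).
Proof. by move=> la; rewrite {1}(e_basis y) (scalar_form_sum la). Qed.

(* The tensor [sum_k e_k (x) u_k] is antisymmetric. *)
Let swap a b : scalar_form a -> scalar_form b ->
  \sum_k a (e k) * b (u k) = - \sum_k a (u k) * b (e k).
Proof.
move=> la lb.
have -> : \sum_k a (e k) * b (u k) = \sum_k \sum_l a (e k) * (eps l (u k) * b (e l)).
  by apply: eq_bigr => k _; rewrite (expand _ lb) mulr_sumr.
rewrite exchange_big -sumrN; apply: eq_bigr => l _ /=.
rewrite (expand _ la) mulr_suml -sumrN; apply: eq_bigr => k _.
by rewrite /u t_anti; ring.
Qed.

Let tfd x m : tangent m (fun f => fd x f m). Proof. by case: (fd_vf x). Qed.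
Let sfd x f : smooth_fun f -> smooth_fun (fd x f).
Proof. by case: (fd_vf x) => + _; apply. Qed.

Let fd_form f m : smooth_fun f -> scalar_form (fun y => fd y f m).
Proof. by move=> sf c y z; exact: fd_lin. Qed.

Let tangent_fd_form (v : (M -> R) -> R) p f : tangent p v -> smooth_fun f ->
  scalar_form (fun y => v (fd y f)).
Proof.
move=> tv sf c y z; have -> : fd (c *: y + z) f = fun m => c * fd y f m + fd z f m.
  by apply/funext => m; exact: fd_lin.
by have [+ _] := tv _ _ (sfd y sf) (sfd z sf) => ->.
Qed.

Let bracket_form x f m : smooth_fun f -> scalar_form (fun y => fd (br x y) f m).
Proof. by move=> sf c y z; rewrite br_lin fd_form. Qed.

Let tME f h m : smooth_fun h -> tM f h m = \sum_k X k f m * Y k h m.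
Proof.
move=> sh; apply: eq_bigr => k _; rewrite /Y (expand _ (fd_form m sh)) mulr_sumr.
by apply: eq_bigr => l _; rewrite /X /u; ring.
Qed.

Let tM_anti f h m : smooth_fun f -> smooth_fun h -> tM f h m = - tM h f m.
Proof.
move=> sf sh; rewrite !tME // (swap (fd_form m sf) (fd_form m sh)).
by congr (- _); apply: eq_bigr => k _; rewrite mulrC.
Qed.

Let smooth_tM f h : smooth_fun f -> smooth_fun h -> smooth_fun (tM f h).
Proof.
move=> sf sh; have -> : tM f h = fun m => \sum_k X k f m * Y k h m.
  by apply/funext => m; rewrite tME.
by apply: smooth_fun_sum => k; apply: smooth_fun_mul; exact: sfd.
Qed.

Let tM_tangent f m : tangent m (fun h => tM f h m).
Proof.
move=> h1 h2 s1 s2; have s12 := smooth_fun_mul s1 s2; split=> [a|].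
  have sa := smooth_fun_add (smooth_fun_scale a s1) s2.
  rewrite !tME // mulr_sumr -big_split; apply: eq_bigr => k _ /=.
  by rewrite /Y; have [+ _] := tfd (u k) m s1 s2 => ->; ring.
rewrite !tME // mulr_sumr mulr_suml -big_split; apply: eq_bigr => k _ /=.
by rewrite /Y (tangentM (tfd (u k) m)) //; ring.
Qed.

Context {F F' : g -> 'Hom(g, R^o) -> 'Hom(g, R^o) -> R}.
Context {phi phi' : 'Hom(g, R^o) -> 'Hom(g, R^o) -> 'Hom(g, R^o) -> R}.
Context (F'E : forall x xi eta,
  F' x xi eta = F x xi eta + eta (br x (t xi)) - xi (br x (t eta))).
Context (phi'E : forall xi eta zeta, phi' xi eta zeta = phi xi eta zeta
  + (F (t zeta) xi eta + F (t xi) eta zeta + F (t eta) zeta xi)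
  + (zeta (br (t xi) (t eta)) + xi (br (t eta) (t zeta))
     + eta (br (t zeta) (t xi)))).
Context {P : (M -> R) -> (M -> R) -> M -> R}.
Context (bP : bivector P).
Context (jacP : forall f1 f2 f3 m, smooth_fun f1 -> smooth_fun f2 -> smooth_fun f3 ->
  half_schouten P f1 f2 f3 m = form3 phi f1 f2 f3 m).
Context (lieP : forall x f1 f2 m, smooth_fun f1 -> smooth_fun f2 ->
  lie_derivative (fd x) P f1 f2 m = - form2 (F x) f1 f2 m).

Let P' f h m := P f h m - tM f h m.

Let tP f m : smooth_fun f -> tangent m (fun h => P f h m).
Proof. by move=> sf; have [/(_ f sf)[_ +] _] := bP; apply. Qed.
Let sP f h : smooth_fun f -> smooth_fun h -> smooth_fun (P f h).
Proof. by move=> sf sh; have [/(_ f sf)[+ _] _] := bP; apply. Qed.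
Let P_anti f h m : smooth_fun f -> smooth_fun h -> P f h m = - P h f m.
Proof. by move=> sf sh; have [_ +] := bP; apply. Qed.

Lemma twisted_bivector : bivector P'.
Proof.
split=> [f sf|f h m sf sh]; last first.
  by rewrite /P' P_anti // (tM_anti m sf sh); ring.
split=> [h sh|m h1 h2 s1 s2].
  by apply: smooth_fun_sub; [exact: sP|exact: smooth_tM].
have [P1 P2] := tP m sf s1 s2; have [T1 T2] := tM_tangent f m s1 s2.
by rewrite /P' P2 T2; split=> [a|]; rewrite ?P1 ?T1; ring.
Qed.

Lemma twisted_lie_derivative x f h m : smooth_fun f -> smooth_fun h ->
  lie_derivative (fd x) P' f h m = - form2 (F' x) f h m.
Proof.
move=> sf sh; have := lieP x m sf sh; rewrite /lie_derivative => LP.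
have F'M : form2 (F' x) f h m = form2 (F x) f h m
    + \sum_k X k f m * fd (br x (u k)) h m
    - \sum_k fd (br x (u k)) f m * X k h m.
  have -> : \sum_k fd (br x (u k)) f m * X k h m =
      \sum_k \sum_l eps k (br x (u l)) * (X k f m * X l h m).
    rewrite exchange_big; apply: eq_bigr => l _ /=.
    rewrite (expand _ (fd_form m sf)) mulr_suml; apply: eq_bigr => k _.
    by rewrite /X; ring.
  have -> : \sum_k X k f m * fd (br x (u k)) h m =
      \sum_k \sum_l eps l (br x (u k)) * (X k f m * X l h m).
    apply: eq_bigr => k _.
    rewrite (expand _ (fd_form m sh)) mulr_sumr; apply: eq_bigr => l _.
    by rewrite /X; ring.
  rewrite /form2 -big_split -sumrB; apply: eq_bigr => k _ /=.
  rewrite -big_split -sumrB; apply: eq_bigr => l _ /=.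
  by rewrite F'E /X /u; ring.
have sPfh := sP sf sh; have stM := smooth_tM sf sh.
have -> : fd x (P' f h) m = fd x (P f h) m - fd x (tM f h) m.
  exact: (tangentB (tfd x m)).
have V_tM : fd x (tM f h) m = \sum_k (fd x (X k f) m * Y k h m + X k f m * fd x (Y k h) m).
  have -> : tM f h = fun m => \sum_k X k f m * Y k h m.
    by apply/funext => p; rewrite tME.
  rewrite (tangent_sum (tfd x m)) => [|k]; last first.
    by apply: smooth_fun_mul; exact: sfd.
  by apply: eq_bigr => k _; rewrite (tangentM (tfd x m)) //; exact: sfd.
have LtM : fd x (tM f h) m - tM (fd x f) h m - tM f (fd x h) m =
    \sum_k X k f m * fd (br x (u k)) h m
    - \sum_k fd (br x (u k)) f m * X k h m.
  rewrite -(swap (bracket_form x m sf) (fd_form m sh)) V_tM !tME //; last exact: sfd.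
  rewrite -!sumrB -big_split; apply: eq_bigr => k _ /=.
  rewrite /X /Y (fd_br x (e k)) //.
  by rewrite (fd_br x (u k)) //; ring.
rewrite F'M /P' opprB addrC; move: LP LtM => + +; lra.
Qed.

Lemma twisted_half_schouten f1 f2 f3 m :
  smooth_fun f1 -> smooth_fun f2 -> smooth_fun f3 ->
  half_schouten P' f1 f2 f3 m = form3 phi' f1 f2 f3 m.
Proof.
pose A1 f h l := \sum_k P f (X k h) m * Y k l m.
pose A2 f h l := \sum_k X k h m * P f (Y k l) m.
pose FF f h l := \sum_k X k f m * form2 (F (u k)) h l m.
pose B1 f h l := \sum_k X k f m * P (Y k h) l m.
pose B2 f h l := \sum_k X k f m * P h (Y k l) m.
pose C1 f h l := \sum_k \sum_n X k f m * (Y k (X n h) m * Y n l m).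
pose C2 f h l := \sum_k \sum_n X k f m * X n h m * Y k (Y n l) m.
pose Q f h l := \sum_k \sum_n X k f m * X n h m * fd (br (u k) (u n)) l m.
have sX k f : smooth_fun f -> smooth_fun (X k f) by exact: sfd.
have sY k f : smooth_fun f -> smooth_fun (Y k f) by exact: sfd.
have E f h l : smooth_fun f -> smooth_fun h -> smooth_fun l ->
    P' f (P' h l) m = P f (P h l) m - A1 f h l - A2 f h l + FF f h l
      - B1 f h l - B2 f h l + C1 f h l + C2 f h l.
  move=> sf sh sl; have sPhl := sP sh sl; have stM := smooth_tM sh sl.
  have tMf : tM h l = fun p => \sum_k X k h p * Y k l p.
    by apply/funext => p; rewrite tME.
  rewrite /P' (tangentB (tP m sf)) // (tangentB (tM_tangent f m)) //.
  have -> : P f (tM h l) m = A1 f h l + A2 f h l.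
    rewrite tMf (tangent_sum (tP m sf)) => [|k]; last by apply: smooth_fun_mul; exact: sfd.
    rewrite -big_split; apply: eq_bigr => k _ /=.
    by rewrite (tangentM (tP m sf)) //; exact: sfd.
  have -> : tM f (P h l) m = - FF f h l + B1 f h l + B2 f h l.
    rewrite tME // -sumrN -!big_split; apply: eq_bigr => k _ /=.
    have := lieP (u k) m sh sl; rewrite /lie_derivative.
    move/eqP; rewrite subr_eq subr_eq => /eqP EY.
    rewrite {1}/Y EY /Y; ring.
  have -> : tM f (tM h l) m = C1 f h l + C2 f h l; last by ring.
  rewrite tME // -big_split; apply: eq_bigr => k _ /=.
  rewrite tMf [Y k _ m](tangent_sum (tfd (u k) m)) => [|n]; last first.
    by apply: smooth_fun_mul; exact: sfd.
  rewrite mulr_sumr -big_split; apply: eq_bigr => n _ /=.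
  rewrite (tangentM (tfd (u k) m)) //; [|exact: sfd|exact: sfd].
  by rewrite /Y; ring.
(* In the cyclic sum [A2] cancels [B1] by antisymmetry of [P], and [A1] cancels
   [B2] by antisymmetry of [t]. *)
have A2E f h l : smooth_fun f -> smooth_fun h -> smooth_fun l ->
    A2 l f h = - B1 f h l.
  move=> sf sh sl; rewrite -sumrN; apply: eq_bigr => k _.
  by rewrite P_anti //; [ring|exact: sfd].
have A1E f h l : smooth_fun f -> smooth_fun h -> smooth_fun l ->
    A1 f h l = - B2 l f h.
  move=> sf sh sl; rewrite /A1 (swap (tangent_fd_form (tP m sf) sh) (fd_form m sl)).
  by congr (- _); apply: eq_bigr => k _; rewrite mulrC.
(* The two second derivatives of [l] in the cyclic sum form a commutator. *)
have CE f h l : smooth_fun f -> smooth_fun h -> smooth_fun l ->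
    C2 f h l + C1 h l f = Q f h l.
  move=> sf sh sl.
  have -> : C1 h l f = - \sum_k \sum_n X k f m * X n h m * Y n (Y k l) m.
    rewrite exchange_big -sumrN; apply: eq_bigr => n _ /=.
    rewrite -mulr_sumr (swap (tangent_fd_form (tfd (u n) m) sl) (fd_form m sf)).
    rewrite mulrN mulr_sumr; congr (- _); apply: eq_bigr => k _.
    by rewrite /X /Y; ring.
  rewrite -sumrB; apply: eq_bigr => k _; rewrite -sumrB; apply: eq_bigr => n _.
  by rewrite /Y (fd_br (u k) (u n)) //; ring.
have phiM f h l : smooth_fun f -> smooth_fun h -> smooth_fun l ->
    form3 phi' f h l m = form3 phi f h l m
      + (FF l f h + FF f h l + FF h l f) + (Q f h l + Q h l f + Q l f h).
  move=> sf sh sl.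
  pose S a := \sum_k \sum_n \sum_p a k n p * (X k f m * X n h m * X p l m).
  have SD a b : S a + S b = S (fun k n p => a k n p + b k n p).
    rewrite /S -big_split; apply: eq_bigr => k _ /=.
    rewrite -big_split; apply: eq_bigr => n _ /=.
    rewrite -big_split; apply: eq_bigr => p _ /=; ring.
  have FFE f' h' l' : FF f' h' l' = \sum_k \sum_n \sum_p
      F (u k) (eps n) (eps p) * (X k f' m * X n h' m * X p l' m).
    apply: eq_bigr => k _; rewrite mulr_sumr; apply: eq_bigr => n _.
    rewrite mulr_sumr; apply: eq_bigr => p _.
    by rewrite /X; ring.
  have QE f' h' l' : smooth_fun l' -> Q f' h' l' = \sum_k \sum_n \sum_p
      eps p (br (u k) (u n)) * (X k f' m * X n h' m * X p l' m).
    move=> sl'; apply: eq_bigr => k _; apply: eq_bigr => n _.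
    rewrite (expand _ (fd_form m sl')) mulr_sumr; apply: eq_bigr => p _.
    by rewrite /X; ring.
  have rot a f' h' l' :
      \sum_k \sum_n \sum_p (a k n p : R) * (X k f' m * X n h' m * X p l' m) =
      \sum_k \sum_n \sum_p a p k n * (X k h' m * X n l' m * X p f' m).
    rewrite exchange_big; apply: eq_bigr => k _ /=.
    rewrite exchange_big; apply: eq_bigr => n _ /=.
    by apply: eq_bigr => p _; ring.
  have FF1 : FF l f h = S (fun k n p => F (u p) (eps k) (eps n)).
    by rewrite FFE rot.
  have FF2 : FF f h l = S (fun k n p => F (u k) (eps n) (eps p)).
    by rewrite FFE.
  have FF3 : FF h l f = S (fun k n p => F (u n) (eps p) (eps k)).
    by rewrite FFE rot rot.
  have Q1 : Q f h l = S (fun k n p => eps p (br (u k) (u n))).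
    by rewrite QE.
  have Q2 : Q h l f = S (fun k n p => eps k (br (u n) (u p))).
    by rewrite QE // rot rot.
  have Q3 : Q l f h = S (fun k n p => eps n (br (u p) (u k))).
    by rewrite QE // rot.
  have Sphi : form3 phi f h l m = S (fun k n p => phi (eps k) (eps n) (eps p)).
    by [].
  rewrite FF1 FF2 FF3 Q1 Q2 Q3 Sphi !SD.
  apply: eq_bigr => k _; apply: eq_bigr => n _; apply: eq_bigr => p _.
  by rewrite phi'E.
move=> s1 s2 s3; rewrite /half_schouten !E // phiM //.
rewrite -jacP // /half_schouten.
rewrite -!CE // (A2E f1 f2 f3) // (A2E f2 f3 f1) // (A2E f3 f1 f2) //.
rewrite !A1E //; ring.
Qed.

End TwistedAction.

Unset Implicit Arguments.
Set Strict Implicit.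
Set Printing Implicit Defensive.

Theorem mainTheorem5 (R : realType) (n : nat)
    (D G : lieGroup R) (iota : G -> D)
    (q : D -> ((D -> R) -> R) -> ((D -> R) -> R) -> R)
    (d : lieAlgebra D) (g : lieAlgebra G) (i : 'Hom(g, d)) (expG : g -> G)
    (h h' : {vspace d})
    (M : manifold R) (act : G -> M -> M) (P : (M -> R) -> (M -> R) -> M -> R) :
  let B := lie_form (d := d) q in
  let F := Ftensor (bracket (l := d)) B i in
  let phi := phitensor (bracket (l := d)) B i in
  let t := twist_tensor B i h h' in
  let P' := fun f1 f2 m => P f1 f2 m - fund2 expG act t f1 f2 m in
  group_pair iota q ->
  lie_differential iota i ->
  manin_pair (bracket (l := d)) n B (limg i) ->
  exponential expG ->
  isotropic_complement B (limg i) h ->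
  isotropic_complement B (limg i) h' ->
  smooth_action act ->
  quasi_poisson_action expG act (F h) (phi h) P ->
  quasi_poisson_action expG act (F h') (phi h') P'.
Proof.
move=> B F phi t P' [_ _ sub] di [_ [Bl Bsym Bnd Binv _] _ [giso _]] expP hC hC' actP.
move=> [bP jacP lieP].
have iinj := differential_inj sub di.
have ibr := differential_bracket sub di.
have brl := bracket_linear_l (g := d); have brr := bracket_linear_r (g := d).
have brDl (x y z : d) : bracket (x + y) z = bracket x z + bracket y z.
  by rewrite -[x]scale1r brl !scale1r.
have brDr (x y z : d) : bracket x (y + z) = bracket x y + bracket x z.
  by rewrite -[y]scale1r brr !scale1r.
have anti := bracket_anti (g := d).
have t_anti xi eta := twist_tensor_anti Bl Bsym Bnd iinj giso hC hC' xi eta.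
have FE x xi eta :=
  Ftensor_twist Bl Bsym Bnd iinj giso hC hC' brDl brDr anti Binv ibr x xi eta.
have phiE xi eta zeta :=
  phitensor_twist Bl Bsym Bnd iinj giso hC hC' brDl brDr anti Binv ibr xi eta zeta.
have vf := fund_vector_field expP actP.
have lin (c : R) x y f m := @fund_linear _ _ _ _ expP _ _ actP c x y f m.
have fbr x y f m := @fund_bracket _ _ _ _ expP _ _ actP x y f m.
have basis (y : g) : y = \sum_k dual_basis (g := g) k y *: (vbasis {:g})`_k.
  rewrite [LHS](coord_vbasis (memvf y)); apply: eq_bigr => k _.
  by rewrite /dual_basis lfunE.
have br_lin := bracket_linear_r (g := g).
pose e (k : 'I_(\dim {:g})) : g := (vbasis {:g})`_k.
split.
- exact: (twisted_bivector (e := e) (t := twist B i h h') vf lin basis t_anti bP).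
- exact: (twisted_half_schouten (e := e) (t := twist B i h h') vf lin fbr basis
    t_anti phiE bP jacP lieP).
- exact: (twisted_lie_derivative (e := e) (t := twist B i h h') br_lin vf lin fbr
    basis t_anti FE bP lieP).
Qed.
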